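(* Let $F$ be a linked field with $\operatorname{char}(F)=2$. Then the possible values of the $u$-invariant of $F$ are $0,2,4$ and $8$; that is, $u(F)\in\{0,2,4,8\}$.
   Context: A quaternion algebra over $F$ is a central simple $F$-algebra of degree $2$. Two quaternion $F$-algebras are linked if they share a common maximal subfield. A field $F$ is linked if every two quaternion $F$-algebras are linked. A quadratic form over $F$ is a map $\varphi:V\to F$ on a finite-dimensional $F$-vector space $V$ with $\varphi(av)=a^2\varphi(v)$ for all $a\in F$, $v\in V$, such that $B_\varphi(v,w)=\varphi(v+w)-\varphi(v)-\varphi(w)$ is bilinear. It is nonsingular if $B_\varphi$ is nondegenerate, and anisotropic if $\varphi(v)\neq0$ for all $v\in V\setminus\{0\}$. The $u$-invariant $u(F)$ is the maximal dimension of an anisotropic nonsingular quadratic form over $F$ of finite order in the Witt group $W_qF$ (also written $I_qF$) of Witt equivalence classes of nonsingular quadratic forms over $F$ under orthogonal sum. When $\operatorname{char}(F)=2$, every nonsingular quadratic form has finite order in this group. *)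

(* Defs.v *)
From HB Require Import structures.
From mathcomp Require Import all_boot all_order all_algebra all_field.

Set Implicit Arguments.
Unset Strict Implicit.
Unset Printing Implicit Defensive.

Import GRing.Theory.
Local Open Scope ring_scope.

Section Quaternion.

Variable F : fieldType.

Definition two_sided_ideal (A : falgType F) (I : {vspace A}) : Prop :=
  (fullv * I <= I)%VS /\ (I * fullv <= I)%VS.

Definition central_simple (A : falgType F) : Prop :=
  'Z({:A})%VS = 1%VS /\
  forall I : {vspace A}, two_sided_ideal I -> I = 0%VS \/ I = fullv.

(* The degree of a central simple algebra is the square root of its dimension. *)
Definition quaternion_algebra (A : falgType F) : Prop :=
  central_simple A /\ \dim {:A} = (2 ^ 2)%N.

(* Subfields of A share the identity of A, so that they contain F.  The type
   {aspace A} is not used since it allows other identity elements. *)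
Definition is_subfield (A : falgType F) (K : {vspace A}) : Prop :=
  [/\ 1 \in K, {in K &, forall x y, x * y \in K},
      {in K &, forall x y, x * y = y * x}
    & {in K, forall x, x != 0 -> exists2 y, y \in K & x * y = 1}].

(* Maximality is with respect to inclusion, so that the notion also makes
   sense in the split algebra M_2(F), which need not contain a quadratic
   extension of F. *)
Definition maximal_subfield (A : falgType F) (K : {vspace A}) : Prop :=
  is_subfield K /\
  forall L : {vspace A}, is_subfield L -> (K <= L)%VS -> L = K.

(* A common maximal subfield is an extension E of F that is F-isomorphic to a
   maximal subfield of A and to a maximal subfield of B. *)
Definition linked_algebras (A B : falgType F) : Prop :=
  exists (E : fieldExtType F) (f : 'AHom(E, A)) (g : 'AHom(E, B)),
    maximal_subfield (limg f) /\ maximal_subfield (limg g).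

End Quaternion.

Definition linked_field (F : fieldType) : Prop :=
  forall A B : falgType F,
    quaternion_algebra A -> quaternion_algebra B -> linked_algebras A B.

Section QuadraticForms.

Variable F : fieldType.

Definition polar (V : vectType F) (q : V -> F) (v w : V) : F :=
  q (v + w) - q v - q w.

Definition quadratic_form (V : vectType F) (q : V -> F) : Prop :=
  [/\ forall (a : F) (v : V), q (a *: v) = a ^+ 2 * q v,
      forall v : V, scalar (polar q v)
    & forall w : V, scalar (fun v : V => polar q v w)].

Definition nonsingular (V : vectType F) (q : V -> F) : Prop :=
  forall v : V, (forall w : V, polar q v w = 0) -> v = 0.

Definition anisotropic (V : vectType F) (q : V -> F) : Prop :=
  forall v : V, v != 0 -> q v != 0.

Definition isometric (V W : vectType F) (q : V -> F) (r : W -> F) : Prop :=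
  exists f : {linear V -> W}, bijective f /\ forall v : V, r (f v) = q v.

Definition orth_sum (V W : vectType F) (q : V -> F) (r : W -> F) :
    (V * W)%type -> F :=
  fun x => q x.1 + r x.2.

(* The orthogonal sum of n copies of q. *)
Definition orth_mul (n : nat) (V : vectType F) (q : V -> F) :
    {ffun 'I_n -> V} -> F :=
  fun x => \sum_(i < n) q (x i).

Definition hyperbolic_plane : (F^o * F^o)%type -> F := fun x => x.1 * x.2.

Definition witt_equiv (V W : vectType F) (q : V -> F) (r : W -> F) : Prop :=
  exists m n : nat,
    isometric (orth_sum q (orth_mul (n := m) hyperbolic_plane))
              (orth_sum r (orth_mul (n := n) hyperbolic_plane)).

Definition zero_form : 'rV[F]_0 -> F := fun=> 0.

Definition finite_witt_order (V : vectType F) (q : V -> F) : Prop :=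
  exists2 n : nat, (0 < n)%N & witt_equiv (orth_mul (n := n) q) zero_form.

Definition u_form_dim (d : nat) : Prop :=
  exists (V : vectType F) (q : V -> F),
    [/\ quadratic_form q, nonsingular q, anisotropic q, finite_witt_order q
      & \dim {:V} = d].

End QuadraticForms.

(* u(F) = n; no such n exists when the dimensions are unbounded. *)
Definition u_invariant_is (F : fieldType) (n : nat) : Prop :=
  u_form_dim F n /\ forall d : nat, u_form_dim F d -> (d <= n)%N.

(* Main.v *)
From Stdlib Require Import Ring Field Classical.
Require Import Defs.
From HB Require Import structures.
From mathcomp Require Import all_boot all_order all_algebra all_field.
From mathcomp Require Import ring.

Set Implicit Arguments.
Unset Strict Implicit.
Unset Printing Implicit Defensive.

Import GRing.Theory.
Local Open Scope ring_scope.

(** The proof replaces linkage by a statement about isotropic vectors and then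
    works with explicit quadratic forms.

    Write [N_e] for the binary form [x^2 + x y + e y^2].  The quaternion algebra
    [[a,b)] has reduced norm [N_a + b N_a] and trace form [y].  A common
    quadratic subfield of [[a,b)] and [[c,d)] provides two noncentral elements
    with the same trace and the same norm, hence an isotropic vector of the
    Albert form [N_(a+c) + b N_a + d N_c] (lemma [linked_albert]).  From there
    on only this isotropy is used: any form [p1 N_w1 + p2 N_w2 + p3 N_w3] with
    [w1 + w2 + w3 = 0] is isotropic.

    In characteristic 2 every nonsingular form is an orthogonal sum of blocks
    [p N_a], so dimensions are even, and every nonsingular form is killed by 2
    in the Witt group.  Two facts therefore suffice: five blocks always form an
    isotropic form, and an anisotropic form with three blocks produces an
    anisotropic form with four blocks, which excludes the value 6.

    The central trick ([herm_triple]) concerns forms [c1 N_e + ... + cn N_e]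
    with a common slot [e], viewed as diagonal hermitian forms [<c1,...,cn>].
    The form [<p, p x> N_e] contains [p N_(e + x n)] for every value [n] of
    [N_e].  Hence an isotropic vector of [<1,x1,x2,x3>] with nonzero first
    entry gives three orthogonal blocks in
    [<p1, p1 x1, p2, p2 x2, p3, p3 x3>] whose slots add up to 0, that is a
    subform similar to an Albert form.  Taking [x1 = x2 = x3] shows that
    3-fold Pfister forms are universal ([herm_pfister_universal]), which is
    the vanishing of the fourth power of the fundamental ideal.  A second use
    shows that hermitian forms of rank 6 and trivial discriminant are isotropic
    ([herm6_isotropic]), and rank 5 follows for every discriminant
    ([herm5_isotropic]).

    Finally, linkage brings three blocks to the shape
    [c1 N_e + c2 N_e + p N_d] ([aniso_three_blocks]).  Applied twice to five
    blocks, together with the choice of a common slot, this gives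
    [<c1,c2,c3,c4> N_e + p N_d], and [herm5_isotropic] says that
    the first summand represents [p], or is isotropic.  Applied to three blocks
    of an anisotropic form it makes [<c1, c2, p, p c2 / c1> N_e] anisotropic,
    because a quaternion norm is multiplicative. *)


(** * Quaternion algebras *)

(** The algebra generated by [i] and [j] with [i^2 = i - a], [j^2 = - b] and
    [j i = (1 - i) j]; with these signs the norm form is
    [N_a(x, y) + b N_a(z, w)] in every characteristic.  A row vector
    is used, and not a product of copies of [F], since products already carry
    a componentwise ring structure. *)
Definition quat (F : fieldType) (a b : F) : Type := 'rV[F]_4.

Section Quat.
Variables (F : fieldType) (a b : F).
HB.instance Definition _ := Vector.on (quat a b).

(** The element [x + y i + (z + w i) j]. *)
Definition Quat (x y z w : F) : quat a b := \row_(i < 4) [:: x; y; z; w]`_i.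

Lemma quatP (u : quat a b) : exists x y z w, u = Quat x y z w.
Proof.
exists (u 0 (inord 0)), (u 0 (inord 1)), (u 0 (inord 2)), (u 0 (inord 3)).
by apply/rowP => -[[|[|[|[|//]]]] lti4]; rewrite mxE /=; congr (u _ _);
  apply/val_inj; rewrite /= inordK.
Qed.

Lemma Quat_inj x y z w x' y' z' w' : Quat x y z w = Quat x' y' z' w' ->
  [/\ x = x', y = y', z = z' & w = w'].
Proof.
move=> /rowP eq_u.
by split; [have := eq_u (inord 0) | have := eq_u (inord 1)
  | have := eq_u (inord 2) | have := eq_u (inord 3)]; rewrite !mxE !inordK.
Qed.

Definition qmul (u v : quat a b) : quat a b :=
  let c i := u 0 (inord i) in let d i := v 0 (inord i) in
  Quat (c 0 * d 0 - a * c 1 * d 1 - b * (c 2 * (d 2 + d 3) + a * c 3 * d 3))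
       (c 0 * d 1 + c 1 * d 0 + c 1 * d 1 - b * (c 3 * d 2 - c 2 * d 3))
       (c 0 * d 2 - a * c 1 * d 3 + c 2 * (d 0 + d 1) + a * c 3 * d 1)
       (c 0 * d 3 + c 1 * d 2 + c 1 * d 3 + c 3 * d 0 - c 2 * d 1).

Lemma QuatD x y z w x' y' z' w' :
  Quat x y z w + Quat x' y' z' w' = Quat (x + x') (y + y') (z + z') (w + w').
Proof. by apply/rowP => -[[|[|[|[|//]]]] lti4]; rewrite !mxE. Qed.
Lemma QuatZ k x y z w : k *: Quat x y z w = Quat (k * x) (k * y) (k * z) (k * w).
Proof. by apply/rowP => -[[|[|[|[|//]]]] lti4]; rewrite !mxE. Qed.
Lemma Quat0 : 0 = Quat 0 0 0 0.
Proof. by apply/rowP => -[[|[|[|[|//]]]] lti4]; rewrite !mxE. Qed.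
Lemma qmulE x y z w x' y' z' w' :
  qmul (Quat x y z w) (Quat x' y' z' w') =
  Quat (x * x' - a * y * y' - b * (z * (z' + w') + a * w * w'))
       (x * y' + y * x' + y * y' - b * (w * z' - z * w'))
       (x * z' - a * y * w' + z * (x' + y') + a * w * y')
       (x * w' + y * z' + y * w' + w * x' - z * y').
Proof. by rewrite /qmul !mxE !inordK. Qed.

Ltac quat_elim u := let x := fresh "x" in let y := fresh "y" in
  let z := fresh "z" in let w := fresh "w" in
  case: (quatP u) => x [y [z [w ->]]].
Ltac quat_ring := rewrite ?(qmulE, QuatD, QuatZ);
   congr Quat; ring.

Lemma qmulA : associative qmul.
Proof. move=> u v t; quat_elim u; quat_elim v; quat_elim t. quat_ring. Qed.
Lemma qmul1q : left_id (Quat 1 0 0 0) qmul.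
Proof. move=> u; quat_elim u; quat_ring. Qed.
Lemma qmulq1 : right_id (Quat 1 0 0 0) qmul.
Proof. move=> u; quat_elim u; quat_ring. Qed.
Lemma qmulDl : left_distributive qmul +%R.
Proof. move=> u v t; quat_elim u; quat_elim v; quat_elim t. quat_ring. Qed.
Lemma qmulDr : right_distributive qmul +%R.
Proof. move=> u v t; quat_elim u; quat_elim v; quat_elim t. quat_ring. Qed.
Lemma quat1_neq0 : Quat 1 0 0 0 != 0.
Proof. by rewrite Quat0; apply/eqP => /Quat_inj[/eqP]; rewrite oner_eq0. Qed.

HB.instance Definition _ := GRing.Zmodule_isNzRing.Build (quat a b)
  qmulA qmul1q qmulq1 qmulDl qmulDr quat1_neq0.

Lemma qscalerAl (k : F) (u v : quat a b) : k *: (u * v) = k *: u * v.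
Proof.
rewrite /GRing.mul /=; quat_elim u; quat_elim v; quat_ring.
Qed.
Lemma qscalerAr (k : F) (u v : quat a b) : k *: (u * v) = u * (k *: v).
Proof. rewrite /GRing.mul /=; quat_elim u; quat_elim v; quat_ring. Qed.
HB.instance Definition _ := GRing.Lmodule_isLalgebra.Build F (quat a b) qscalerAl.
HB.instance Definition _ := GRing.Lalgebra_isAlgebra.Build F (quat a b) qscalerAr.
HB.instance Definition _ := Algebra_isFalgebra.Build F (quat a b).

Lemma QuatM x y z w x' y' z' w' :
  Quat x y z w * Quat x' y' z' w' =
  Quat (x * x' - a * y * y' - b * (z * (z' + w') + a * w * w'))
       (x * y' + y * x' + y * y' - b * (w * z' - z * w'))
       (x * z' - a * y * w' + z * (x' + y') + a * w * y')
       (x * w' + y * z' + y * w' + w * x' - z * y').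
Proof. exact: qmulE. Qed.
Lemma Quat1 : 1 = Quat 1 0 0 0.
Proof. by []. Qed.

Lemma dim_quat : \dim {:quat a b} = 4%N.
Proof. by rewrite dimvf /dim /= mul1n. Qed.
End Quat.


(** * Ring and field normalization in characteristic 2 *)

Section Char2Field.
Variables (F : fieldType) (charF : 2%N \in [pchar F]).

(** Copies of the field operations that do not go through the algebraic
    hierarchy: reification compares head symbols syntactically, whereas the same
    operation of [F] may occur with several canonical instances.  With
    coefficients in the booleans the normalization uses [2 = 0]. *)
Definition f0 : F := 0.
Definition f1 : F := 1.
Definition fadd (x y : F) : F := x + y.
Definition fmul (x y : F) : F := x * y.
Definition fopp (x : F) : F := - x.
Definition finv (x : F) : F := x^-1.
Definition fsub (x y : F) : F := x - y.
Definition fdiv (x y : F) : F := x / y.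
Definition fbool (b : bool) : F := if b then 1 else 0.

Lemma addff (x : F) : x + x = 0.
Proof. by rewrite -mulr2n -mulr_natr (pcharf0 charF) mulr0. Qed.
Lemma oppff (x : F) : - x = x.
Proof. by apply/eqP; rewrite -subr_eq0 -opprD addff oppr0. Qed.

Lemma f0E : 0 = f0. Proof. by []. Qed.
Lemma f1E : 1 = f1. Proof. by []. Qed.
Lemma faddE x y : x + y = fadd x y. Proof. by []. Qed.
Lemma fmulE x y : x * y = fmul x y. Proof. by []. Qed.
Lemma foppE x : - x = fopp x. Proof. by []. Qed.
Lemma finvE x : x^-1 = finv x. Proof. by []. Qed.

Lemma char2_field_theory : field_theory f0 f1 fadd fmul fsub fopp fdiv finv eq.
Proof.
split=> //; [|exact/eqP/oner_neq0|by move=> p /eqP; apply: mulVf].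
split=> //; [exact: add0r|exact: addrC|exact: addrA|exact: mul1r|exact: mulrC
  |exact: mulrA|exact: mulrDl|exact: subrr].
Qed.
Lemma fbool_morph : ring_morph f0 f1 fadd fmul fsub fopp eq
  false true xorb andb xorb id Bool.eqb fbool.
Proof.
split=> //=.
- by case=> -[]; rewrite /= /fbool /fadd ?add0r ?addr0 ?addff.
- by case=> -[]; rewrite /= /fbool /fsub ?oppff ?add0r ?addr0 ?addff ?oppr0.
- by case=> -[]; rewrite /= /fbool /fmul ?mul1r ?mul0r.
- by case; rewrite /fbool /fopp ?oppff ?oppr0.
- by case=> -[].
Qed.
End Char2Field.

Section CharTwo.
Variables (F : fieldType) (charF : 2%N \in [pchar F]).
Ltac char2_const t := match t with
  | f0 F => constr:(false)
  | f1 F => constr:(true)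
  | _ => constr:(InitialRing.NotConstant)
  end.
Add Field char2_struct : (char2_field_theory F)
  (morphism (fbool_morph charF), constants [char2_const]).

Ltac char2_norm :=
  rewrite ?expr2 ?faddE ?fmulE ?foppE ?finvE ?f0E ?f1E;
  match goal with |- @eq _ ?x ?y => change (@eq F x y) end.
Ltac char2_ring :=
  char2_norm; let G := Get_goal in ring_lookup (PackRing Ring_gen) [] G.
Ltac char2_field :=
  char2_norm; (let G := Get_goal in field_lookup (PackField FIELD) [] G);
  rewrite /fadd /fmul /fopp /finv /f0 /f1; repeat split; try exact/eqP.

(** * Central simplicity and the Albert form *)

Ltac by_quat h := match goal with |- is_true (in_mem ?v _) =>
  match type of h with is_true (in_mem ?u _) =>
    suff -> : v = u; [exact: h | congr Quat] end end.

(** The norm form of [F[i]] with [i^2 + i = e]; squares are written as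
    products so that normalization needs no power operation. *)
Definition nrm (e : F) (n : F * F) : F := n.1 * n.1 + n.1 * n.2 + e * (n.2 * n.2).

Lemma quat_quadratic (a b x y z w : F) : let u := Quat a b x y z w in
  u * u = y *: u + (nrm a (x, y) + b * nrm a (z, w)) *: 1.
Proof.
by move=> u; rewrite /u Quat1 QuatM !QuatZ QuatD /nrm /=; congr Quat; char2_ring.
Qed.

Lemma quat_center (a b : F) : 'Z({:quat a b})%VS = 1%VS.
Proof.
apply/eqP; rewrite eqEsubv; apply/andP; split; last first.
  by rewrite -memvE memv_cap memvf centv1.
apply/subvP => u; rewrite memv_cap memvf => /centvP cu.
have [x [y [z [w def_u]]]] := quatP u.
have /esym := cu (Quat a b 0 1 0 0) (memvf _); rewrite def_u !QuatM.
move=> /Quat_inj[_ _ e1 e2].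
have /esym := cu (Quat a b 0 0 1 0) (memvf _); rewrite def_u !QuatM.
move=> /Quat_inj[_ _ e3 _].
have z0 : z = 0.
  transitivity (x * 0 - a * y * 0 + z * (0 + 1) + a * w * 1 - (0 * z - a * 1 * w + 0 *
    (x + y) + a * 0 * y)).
    by char2_ring.
  by rewrite e1 subrr.
have w0 : w = 0.
  transitivity (0 * w + 1 * z + 1 * w + 0 * x - 0 * y - (x * 0 + y * 0 + y * 0 + w * 0
    - z * 1)); first by char2_ring.
  by rewrite e2 subrr.
have y0 : y = 0.
  transitivity (0 * z - a * 0 * w + 1 * (x + y) + a * 0 * y - (x * 1 - a * y * 0 + z *
    (0 + 0) + a * w * 0)); first by char2_ring.
  by rewrite e3 subrr.
by apply/vlineP; exists x; rewrite Quat1 QuatZ y0 z0 w0 mulr1 !mulr0.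
Qed.

(** For [u = k + l j] in the ideal, with [k] and [l] in [F[i]], the commutator
    with [i] is [l j], so the ideal meets [F[i]]
    nontrivially.  There the sum of an element and its conjugate, obtained by
    conjugation with [j], is a scalar. *)
Lemma quat_simple (a b : F) (I : {vspace quat a b}) : b != 0 ->
  two_sided_ideal I -> I = 0%VS \/ I = fullv.
Proof.
move=> b0 [/prodvP Il /prodvP Ir].
have {}Il u v : v \in I -> u * v \in I by move=> vI; apply: Il; rewrite ?memvf.
have {}Ir u v : u \in I -> u * v \in I by move=> uI; apply: Ir => //; rewrite memvf.
case: (boolP (I == 0%VS)) => [/eqP|I0]; first by left.
right; apply/eqP; rewrite eqEsubv subvf /=; apply/subvP => v _.
suff one : 1 \in I by rewrite -[v]mulr1; apply: Il.
have scal (k : F) : k != 0 -> Quat a b k 0 0 0 \in I -> 1 \in I.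
  move=> k0 /(Il (Quat a b k^-1 0 0 0)); rewrite QuatM Quat1.
  by move=> h; by_quat h; char2_field.
have inK (x y : F) : (x != 0) || (y != 0) -> Quat a b x y 0 0 \in I -> 1 \in I.
  move=> xy uI.
  have : b^-1 *: (Quat a b 0 0 1 0 * Quat a b x y 0 0 * Quat a b 0 0 1 0) + Quat a b x
    y 0 0 \in I.
    by rewrite memvD // memvZ // Ir // Il.
  rewrite !QuatM QuatZ QuatD.
  case: (eqVneq y 0) xy uI => [->|y0 _ _]; first by rewrite /= orbF => x0 /(scal _ x0).
  move=> h; apply: (scal y) => //; by_quat h; char2_field.
have [u uI u0] : exists2 u, u \in I & u != 0.
  by exists (vpick I); rewrite ?memv_pick ?vpick0.
have [x [y [z [w def_u]]]] := quatP u.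
case: (boolP ((z != 0) || (w != 0))) => zw.
  apply: (inK (b * z) (b * w)); first by rewrite !mulf_eq0 !negb_or b0 zw.
  have : (Quat a b 0 1 0 0 * u + u * Quat a b 0 1 0 0) * Quat a b 0 0 1 0 \in I.
    by apply: (Ir); apply: memvD; [apply: Il | apply: Ir].
  rewrite def_u !QuatM !QuatD QuatM => h; by_quat h; char2_ring.
apply: (inK x y); last first.
  by move: zw uI; rewrite negb_or !negbK def_u => /andP[/eqP -> /eqP ->].
apply: contraNT u0; rewrite negb_or !negbK => /andP[/eqP x0 /eqP y0].
move: zw; rewrite negb_or !negbK def_u x0 y0 => /andP[/eqP -> /eqP ->].
by rewrite Quat0.
Qed.

Lemma quat_quaternion (a b : F) : b != 0 -> quaternion_algebra (quat a b).
Proof.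
move=> b0; split; last exact: dim_quat.
by split; [exact: quat_center | move=> I; apply: quat_simple].
Qed.

Definition nonzero3 (n1 n2 n3 : F * F) :=
  [|| n1 != (0, 0), n2 != (0, 0) | n3 != (0, 0)].

Lemma quat_not_scalar (a b x y z w : F) :
  Quat a b x y z w \notin 1%VS -> [|| y != 0, z != 0 | w != 0].
Proof.
apply: contraNT; rewrite !negb_or !negbK => /and3P[/eqP-> /eqP-> /eqP->].
by apply/vlineP; exists x; rewrite Quat1 QuatZ mulr1 !mulr0.
Qed.

Lemma ahom_inj (E : fieldExtType F) (A : falgType F) (f : 'AHom(E, A)) (s t : E) :
  f s = f t -> s = t.
Proof. exact: fmorph_inj. Qed.

Lemma ahom_not_scalar (E : fieldExtType F) (A : falgType F) (f : 'AHom(E, A)) (t : E) :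
  t \notin 1%VS -> f t \notin 1%VS.
Proof.
apply: contraNN => /vlineP[k ftk]; apply/vlineP; exists k.
by apply: (@ahom_inj _ _ f); rewrite ftk linearZ rmorph1.
Qed.

(** If [N_a(t, 1)] never vanishes then [F[i]] is a field, larger than [F]. This
    handles fields without quadratic extensions, over which the split algebra
    has [F] as a maximal subfield. *)
Lemma root_of_base_maximal (a b : F) (K : {vspace quat a b}) :
  maximal_subfield K -> (K <= 1)%VS -> exists t, nrm a (t, 1) = 0.
Proof.
move=> [_ maxK] K1.
have [//|ani] := classic (exists t, nrm a (t, 1) = 0).
pose i : quat a b := Quat a b 0 1 0 0.
pose L : {vspace quat a b} := (1 + <[i]>)%VS.
have memL u : u \in L <-> exists x y, u = Quat a b x y 0 0.
  split.
    move=> /memv_addP[_ /vlineP[x ->] [_ /vlineP[y ->] ->]]; exists x, y.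
    by rewrite Quat1 /i !QuatZ QuatD; congr Quat; char2_ring.
  move=> [x [y ->]]; apply/memv_addP; exists (x *: 1); first exact: memvZ (memv_line _).
  exists (y *: i); first exact: memvZ (memv_line _).
  by rewrite Quat1 /i !QuatZ QuatD; congr Quat; char2_ring.
have fieldL : is_subfield L.
  split.
  - by apply/memL; exists 1, 0.
  - move=> u v /memL[x [y ->]] /memL[z [w ->]]; rewrite QuatM; apply/memL.
    by eexists _, _; congr Quat; char2_ring.
  - move=> u v /memL[x [y ->]] /memL[z [w ->]]; rewrite !QuatM.
    by congr Quat; char2_ring.
  move=> u /memL[x [y ->]] u0.
  have n0 : nrm a (x, y) != 0.
    apply/eqP => nxy; have [y0|y0] := eqVneq y 0.
      move: nxy u0; rewrite /nrm /= y0 !mulr0 !addr0 => /eqP;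
        rewrite mulf_eq0 orbb => /eqP->.
      by rewrite Quat0 eqxx.
    apply: ani; exists (x / y); transitivity (nrm a (x, y) / (y * y));
      last by rewrite nxy mul0r.
    by rewrite /nrm /=; char2_field.
  exists (Quat a b ((x + y) / nrm a (x, y)) (- y / nrm a (x, y)) 0 0).
    by apply/memL; eexists _, _.
  by rewrite QuatM Quat1; congr Quat; move: n0; rewrite /nrm /= => n0; char2_field.
have : i \in (1 : {vspace quat a b})%VS.
  apply: (subvP K1); rewrite -(maxK L) //; first by apply/memL; exists 0, 1.
  by apply: subv_trans (K1) _; apply: addvSl.
by move=> /vlineP[k]; rewrite Quat1 QuatZ => /Quat_inj[_ /eqP]; rewrite mulr0 oner_eq0.
Qed.

(** The elements [f t] and [g t] satisfy the same quadratic equation over [F].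
    Their coordinates provide the isotropic vector: the first block evaluates
    at the sum of the scalar parts and at the common trace. *)
Lemma linked_albert : linked_field F ->
  forall a b c d : F, b != 0 -> d != 0 -> exists n1 n2 n3,
  nonzero3 n1 n2 n3 /\ nrm (a + c) n1 + b * nrm a n2 + d * nrm c n3 = 0.
Proof.
move=> linkF a b c d b0 d0.
have [E [f [g [maxf maxg]]]] := linkF _ _ (quat_quaternion a b0) (quat_quaternion c d0).
have [[t tN]|E1] := classic (exists t : E, t \notin 1%VS); last first.
  have im1 (A : falgType F) (h : 'AHom(E, A)) : (limg h <= 1)%VS.
    apply/subvP => _ /memv_imgP[t _ ->].
    have /vlineP[k ->] : t \in 1%VS by apply/negPn/negP => tN; apply: E1; exists t.
    by rewrite linearZ rmorph1; apply/vlineP; exists k.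
  have [x fx] := root_of_base_maximal maxf (im1 _ f).
  have [y gy] := root_of_base_maximal maxg (im1 _ g).
  exists (x + y, 1), (0, 0), (0, 0); split.
    by rewrite /nonzero3 xpair_eqE oner_eq0 andbF.
  transitivity (nrm a (x, 1) + nrm c (y, 1)); last by rewrite fx gy addr0.
  by rewrite /nrm /=; char2_ring.
have [x [y [z [w ft]]]] := quatP (f t).
have [x' [y' [z' [w' gt]]]] := quatP (g t).
have := ahom_not_scalar f tN; rewrite ft => /quat_not_scalar u0.
have tf : t * t = y *: t + (nrm a (x, y) + b * nrm a (z, w)) *: 1.
  apply: (@ahom_inj _ _ f); rewrite rmorphM linearD !linearZ rmorph1 /= ft.
  exact: quat_quadratic.
have tg : t * t = y' *: t + (nrm c (x', y') + d * nrm c (z', w')) *: 1.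
  apply: (@ahom_inj _ _ g); rewrite rmorphM linearD !linearZ rmorph1 /= gt.
  exact: quat_quadratic.
have eq_yN : y = y' /\ nrm a (x, y) + b * nrm a (z, w) = nrm c (x',
  y') + d * nrm c (z', w').
  move: tg; rewrite tf; move: (_ + _ * _) (_ + _ * _) => n n' /eqP.
  rewrite -subr_eq0 opprD addrACA -!scalerBl addr_eq0 => /eqP eq_t.
  have yy : y = y'.
    apply/eqP; apply: contraNT tN => yy; apply/vlineP;
      exists (- (y - y')^-1 * (n' - n)).
    rewrite -scalerA scaleNr -scalerN -eq_t scalerA mulVf ?scale1r //.
    by rewrite subr_eq0.
  split=> //; move/eqP: eq_t; rewrite yy subrr scale0r eq_sym oppr_eq0 scaler_eq0.
  by rewrite oner_eq0 orbF subr_eq0 => /eqP.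
case: eq_yN => yy nn; subst y'.
exists (x + x', y), (z, w), (z', w'); split.
  rewrite /nonzero3 !xpair_eqE !negb_and; apply: contraTT u0.
  by rewrite !negb_or !negbK => /and3P[/andP[_ ->] /andP[-> ->] _].
transitivity (nrm a (x, y) + b * nrm a (z, w) + (nrm c (x', y) + d * nrm c (z', w'))).
  by rewrite /nrm /=; char2_ring.
by rewrite nn (addff charF).
Qed.

(** * Orthogonal sums of binary forms *)

(** A list entry [(p, a)] stands for the block [p N_a]. *)
Fixpoint eval_blocks (l ns : seq (F * F)) : F :=
  match l, ns with
  | b :: l', n :: ns' => b.1 * nrm b.2 n + eval_blocks l' ns'
  | _, _ => 0
  end.

Definition aniso (l : seq (F * F)) := forall ns : seq (F * F),
  size ns = size l -> eval_blocks l ns = 0 -> all (pred1 (0, 0)) ns.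

Lemma nrm0 e : nrm e (0, 0) = 0.
Proof. by rewrite /nrm /=; char2_ring. Qed.

Lemma eval_blocks_sum l ns : size ns = size l -> eval_blocks l ns =
  \sum_(i <- iota 0 (size l)) (nth (0, 0) l i).1 * nrm (nth (0, 0) l i).2 (nth (0,
    0) ns i).
Proof.
elim: l ns => [|b l IHl] [|n ns] //=; first by rewrite big_nil.
by case=> /IHl ->; rewrite big_cons /= (iotaDl 1 0) big_map.
Qed.

Lemma eval_blocks_cat l r ns ms : size ns = size l ->
  eval_blocks (l ++ r) (ns ++ ms) = eval_blocks l ns + eval_blocks r ms.
Proof.
elim: l ns => [|b l IHl] [|n ns] //=; first by rewrite add0r.
by case=> /IHl ->; rewrite addrA.
Qed.

Lemma not_aniso l : ~ aniso l ->
  exists ns, [/\ size ns = size l, eval_blocks l ns = 0 & ~~ all (pred1 (0, 0)) ns].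
Proof.
move=> nal; have [//|no] := classic (exists ns, [/\ size ns = size l,
  eval_blocks l ns = 0 & ~~ all (pred1 (0, 0)) ns]).
case: nal => ns sz e0; case: (boolP (all _ ns)) => // nz.
by case: no; exists ns.
Qed.

Lemma aniso_shuffle (Is : seq nat) l : aniso l ->
  perm_eq Is (iota 0 (size l)) -> aniso [seq nth (0, 0) l i | i <- Is].
Proof.
move=> al pI ns; rewrite size_map => sz ev0.
have uI : uniq Is by rewrite (perm_uniq pI) iota_uniq.
have szI : size Is = size l by rewrite (perm_size pI) size_iota.
have memI i : (i \in Is) = (i < size l)%N by rewrite (perm_mem pI) mem_iota.
pose ms := mkseq (fun i => nth (0, 0) ns (index i Is)) (size l).
have nthm j : (j < size l)%N -> nth (0, 0) ms (nth 0%N Is j) = nth (0, 0) ns j.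
  by move=> ltj; rewrite nth_mkseq -?memI ?mem_nth ?szI // index_uniq ?szI.
have /(al ms) : size ms = size l by rewrite size_mkseq.
rewrite eval_blocks_sum ?size_mkseq // -(perm_big _ pI) /= (big_nth 0%N) => anis.
have /anis/(all_nthP (0, 0)) nz : \sum_(0 <= j < size Is)
   (nth (0, 0) l (nth 0%N Is j)).1 * nrm (nth (0, 0) l (nth 0%N Is j)).2
       (nth (0, 0) ms (nth 0%N Is j)) = 0.
  rewrite -[RHS]ev0 eval_blocks_sum ?size_map // /index_iota subn0 big_seq [RHS]big_seq.
  apply: eq_bigr => j; rewrite mem_iota /= add0n szI => ltj.
  by rewrite nthm // (nth_map 0%N) // szI.
apply/(all_nthP (0, 0)) => j; rewrite sz szI => ltj; rewrite -nthm //.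
by apply: nz; rewrite size_mkseq -memI mem_nth // szI.
Qed.

Lemma aniso_take k l : aniso l -> aniso (take k l).
Proof.
rewrite -{1}(cat_take_drop k l); move: (take k l) (drop k l) => {}l r al ns sz e0.
have := al (ns ++ nseq (size r) (0, 0)); rewrite !size_cat size_nseq sz
  eval_blocks_cat // e0.
have -> : eval_blocks r (nseq (size r) (0, 0)) = 0.
  by elim: r {al} => //= b r ->; rewrite nrm0 mulr0 addr0.
by rewrite addr0 all_cat => /(_ erefl erefl)/andP[].
Qed.

Lemma aniso_sel k (Is : seq nat) l : perm_eq Is (iota 0 (size l)) ->
  aniso l -> aniso (take k [seq nth (0, 0) l i | i <- Is]).
Proof. by move=> pI al; apply/aniso_take/aniso_shuffle. Qed.

Lemma aniso_perm l r : perm_eq l r -> aniso l -> aniso r.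
Proof.
rewrite perm_sym => /(perm_iotaP (0, 0))[Is pI ->] al.
exact: aniso_shuffle.
Qed.

(** Isometric embeddings are only needed through their effect on values and on
    zero vectors, so linearity of the change of coordinates is not recorded. *)
Lemma aniso_head1 b c r :
  (forall n, exists2 m, b.1 * nrm b.2 m = c.1 * nrm c.2 n & m = (0, 0) -> n = (0, 0)) ->
  aniso (b :: r) -> aniso (c :: r).
Proof.
move=> sub al [|n ns] //= [sz] e0; have [m em m0] := sub n.
have /= := al (m :: ns); rewrite sz em => /(_ erefl e0)/andP[/eqP/m0 -> ->].
by rewrite eqxx.
Qed.

Lemma aniso_head2 b1 b2 c1 c2 r :
  (forall n1 n2, exists m1 m2,
     b1.1 * nrm b1.2 m1 + b2.1 * nrm b2.2 m2 = c1.1 * nrm c1.2 n1 + c2.1 * nrm c2.2 n2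
       /\
     (m1 = (0, 0) -> m2 = (0, 0) -> n1 = (0, 0) /\ n2 = (0, 0))) ->
  aniso (b1 :: b2 :: r) -> aniso (c1 :: c2 :: r).
Proof.
move=> sub al [|n1 [|n2 ns]] //= [sz] e0; have [m1 [m2 [em m0]]] := sub n1 n2.
have /= := al (m1 :: m2 :: ns); rewrite sz addrA em -addrA => /(_ erefl e0).
by case/and3P => /eqP/m0 m1z /eqP/m1z[-> ->] ->; rewrite !eqxx.
Qed.

Lemma aniso_nrm_eq0 p a r n : aniso ((p, a) :: r) -> nrm a n = 0 -> n = (0, 0).
Proof.
move=> /(@aniso_take 1%N _); rewrite /= take0 => al n0; have /= := al [:: n] erefl.
by rewrite /= n0 mulr0 addr0 => /(_ erefl); rewrite andbT => /eqP.
Qed.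

Lemma aniso_neq0 p a r : aniso ((p, a) :: r) -> p != 0.
Proof.
move=> /(@aniso_take 1%N _); rewrite /= take0 => al; apply/eqP => p0;
  have /= := al [:: (1, 0)] erefl.
rewrite /= p0 mul0r addr0 => /(_ erefl); rewrite andbT => /eqP[/eqP].
by rewrite oner_eq0.
Qed.

(** Multiplication and conjugation of the quadratic algebra whose norm is
    [nrm e]. *)
Definition kmul (e : F) (n m : F * F) : F * F :=
  (n.1 * m.1 + e * (n.2 * m.2), n.1 * m.2 + n.2 * m.1 + n.2 * m.2).
Definition kconj (n : F * F) : F * F := (n.1 + n.2, n.2).

Lemma nrm_kmul e n m : nrm e (kmul e n m) = nrm e n * nrm e m.
Proof. by rewrite /nrm /kmul /=; char2_ring. Qed.
Lemma nrm_scal e t : nrm e (t, 0) = t * t.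
Proof. by rewrite /nrm /=; char2_ring. Qed.
Lemma nrm_kscal e t n : nrm e (t * n.1, t * n.2) = t * t * nrm e n.
Proof. by rewrite /nrm /=; char2_ring. Qed.

(** Multiply by the conjugate of [n]. *)
Lemma kmul_eq0 e n m : nrm e n != 0 -> kmul e n m = (0, 0) -> m = (0, 0).
Proof.
case: n m => n1 n2 [m1 m2] n0 [h1 h2].
suff [u v] : m1 = 0 /\ m2 = 0 by rewrite u v.
split; apply: (mulfI n0); rewrite mulr0.
  transitivity ((n1 + n2) * (n1 * m1 + e * (n2 * m2)) +
    e * (n2 * (n1 * m2 + n2 * m1 + n2 * m2))); last by rewrite h1 h2 !mulr0 addr0.
  by rewrite /nrm /=; char2_ring.
transitivity (n1 * (n1 * m2 + n2 * m1 + n2 * m2) + n2 * (n1 * m1 + e * (n2 * m2)));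
  last by rewrite h1 h2 !mulr0 addr0.
by rewrite /nrm /=; char2_ring.
Qed.

Lemma aniso_scale p a n r : nrm a n != 0 -> aniso ((p, a) :: r) ->
  aniso ((p * nrm a n, a) :: r).
Proof.
move=> n0; apply: aniso_head1 => m /=; exists (kmul a n m).
  by rewrite nrm_kmul mulrA.
exact: kmul_eq0.
Qed.

(** Substituting [x + t y] for [x] changes the slot by [t^2 + t]. *)
Lemma aniso_artin_schreier p a t r : aniso ((p, a) :: r) ->
  aniso ((p, a + (t * t + t)) :: r).
Proof.
apply: aniso_head1 => -[x y] /=; exists (x + t * y, y).
  by rewrite /nrm /=; char2_ring.
by case=> + y0; rewrite y0 mulr0 addr0 => ->.
Qed.

Lemma kmulr0 e n : kmul e n (0, 0) = (0, 0).
Proof. by rewrite /kmul /=; congr (_, _); char2_ring. Qed.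

(** In the hermitian plane [<c1, c2>] the vector [(n1, n2)] of value [x] is
    orthogonal to [(c2 n2', c1 n1')], with conjugates [n1'] and [n2'], whose
    value is [c1 c2 x]. *)
Lemma aniso_diag e c1 c2 n1 n2 r (x := c1 * nrm e n1 + c2 * nrm e n2) : x != 0 ->
  aniso ((c1, e) :: (c2, e) :: r) -> aniso ((x, e) :: (c1 * c2 * x, e) :: r).
Proof.
move=> x0; apply: aniso_head2 => m1 m2 /=.
pose p := kmul e m1 n1; pose q := kmul e m2 (kconj n2).
pose p' := kmul e m1 n2; pose q' := kmul e m2 (kconj n1).
exists (p.1 + c2 * q.1, p.2 + c2 * q.2), (p'.1 + c1 * q'.1, p'.2 + c1 * q'.2).
split.
  by rewrite /x /p /q /p' /q' /nrm /kconj /kmul /=; char2_ring.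
move=> z1 z2; rewrite [m1]surjective_pairing [m2]surjective_pairing.
have {}z1 n : kmul e n (p.1 + c2 * q.1, p.2 + c2 * q.2) = (0, 0).
  by rewrite z1 kmulr0.
have {}z2 n : kmul e n (p'.1 + c1 * q'.1, p'.2 + c1 * q'.2) = (0, 0).
  by rewrite z2 kmulr0.
split; congr (_, _); apply: (mulfI x0); rewrite mulr0.
- transitivity (c1 * (kmul e (kconj n1) (p.1 + c2 * q.1, p.2 + c2 * q.2)).1 +
     c2 * (kmul e (kconj n2) (p'.1 + c1 * q'.1, p'.2 + c1 * q'.2)).1); last first.
    by rewrite z1 z2 !mulr0 addr0.
  by rewrite /x /p /q /p' /q' /nrm /kconj /kmul /=; char2_ring.
- transitivity (c1 * (kmul e (kconj n1) (p.1 + c2 * q.1, p.2 + c2 * q.2)).2 +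
     c2 * (kmul e (kconj n2) (p'.1 + c1 * q'.1, p'.2 + c1 * q'.2)).2); last first.
    by rewrite z1 z2 !mulr0 addr0.
  by rewrite /x /p /q /p' /q' /nrm /kconj /kmul /=; char2_ring.
- transitivity ((kmul e n2 (p.1 + c2 * q.1, p.2 + c2 * q.2)).1 +
     (kmul e n1 (p'.1 + c1 * q'.1, p'.2 + c1 * q'.2)).1); last first.
    by rewrite z1 z2 addr0.
  by rewrite /x /p /q /p' /q' /nrm /kconj /kmul /=; char2_ring.
transitivity ((kmul e n2 (p.1 + c2 * q.1, p.2 + c2 * q.2)).2 +
     (kmul e n1 (p'.1 + c1 * q'.1, p'.2 + c1 * q'.2)).2); last first.
  by rewrite z1 z2 addr0.
by rewrite /x /p /q /p' /q' /nrm /kconj /kmul /=; char2_ring.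
Qed.

(** Multiplicativity of the norm of the quaternion algebra [[e, A)]. *)
Lemma quat_norm_mul e A n1 n2 m1 m2 : exists k1 k2,
  (nrm e n1 + A * nrm e n2) * (nrm e m1 + A * nrm e m2) = nrm e k1 + A * nrm e k2.
Proof.
pose p := kmul e m1 n1; pose q := kmul e m2 (kconj n2).
pose p' := kmul e m1 n2; pose q' := kmul e m2 (kconj n1).
exists (p.1 + A * q.1, p.2 + A * q.2), (p'.1 + q'.1, p'.2 + q'.2).
by rewrite /p /q /p' /q' /nrm /kconj /kmul /=; char2_ring.
Qed.

(** The hermitian form [<c1,...,cn>] over [F[i]], [i^2 + i = e]. *)
Definition herm (e : F) (cs : seq F) := [seq (c, e) | c <- cs].

(** Coefficients matter only up to norms, and the form only up to similarity. *)
Lemma aniso_norms e k (cs : seq F) (ns : seq (F * F)) : k != 0 ->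
  size ns = size cs -> all (fun n => nrm e n != 0) ns ->
  aniso (herm e cs) -> aniso (herm e [seq k * (c.1 * nrm e c.2) | c <- zip cs ns]).
Proof.
move=> k0 szn nz al ms; rewrite !size_map size_zip szn minnn => szm ev0.
have {al} := al [seq kmul e n.1 n.2 | n <- zip ns ms].
rewrite !size_map size_zip szn szm minnn => /(_ erefl) al.
have {al} : all (pred1 (0, 0)) [seq kmul e n.1 n.2 | n <- zip ns ms].
  apply: al; apply: (mulfI k0); rewrite mulr0 -[RHS]ev0.
  elim: cs ns ms szn szm {nz ev0} => [|c cs IHcs] [|n ns] [|m ms] //=;
    rewrite ?mulr0 //.
  by move=> [szn] [szm]; rewrite mulrDr IHcs // nrm_kmul !mulrA.
elim: ns ms cs nz szn szm {ev0} => [|n ns IHns] [|m ms] [|c cs] //= /andP[n0 nz] [szn]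
  [szm].
by case/andP => /eqP/(kmul_eq0 n0) -> /(IHns _ _ nz szn szm) ->; rewrite eqxx.
Qed.

(** A nonzero value can be made the first diagonal coefficient; [aniso_diag] is
    iterated along the list.  The discriminant is preserved up to a norm. *)
Lemma herm_value e cs ns (t := eval_blocks (herm e cs) ns) :
  size ns = size cs -> t != 0 ->
  exists cs' k, [/\ size (t :: cs') = size cs,
    t * (\prod_(c <- cs') c) = nrm e k * (\prod_(c <- cs) c) &
    forall r, aniso (herm e cs ++ r) -> aniso (herm e (t :: cs') ++ r)].
Proof.
elim: cs ns @t => [|c cs IHcs] [|n ns] //=; first by rewrite eqxx.
move=> [sz]; set t0 := eval_blocks _ ns; have [t00|t0N] := eqVneq t0 0.
  rewrite t00 addr0 mulf_eq0 negb_or => /andP[_ n0].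
  exists cs, n; split=> // [|r]; first by rewrite !big_cons mulrAC mulrA mulrC mulrA.
  exact: aniso_scale.
have [cs' [k [szc pr an]]] := IHcs ns sz t0N => tN.
have def_t : c * nrm e n + t0 = c * nrm e n + t0 * nrm e (1, 0).
  by rewrite nrm_scal !mulr1.
exists (c * t0 * (c * nrm e n + t0) :: cs'), (kmul e k (c * nrm e n + t0, 0)); split.
- by rewrite /= -szc.
- rewrite !big_cons nrm_kmul nrm_scal; move: pr; rewrite -/t0.
  move: (_ + t0) (\prod_(j <- cs') j) (\prod_(j <- cs) j) => x P Q pr.
  by transitivity (x * x * c * (t0 * P)); [char2_ring | rewrite pr; char2_ring].
move=> r al; rewrite /= def_t; apply: aniso_diag; first by rewrite -def_t.
have mid s : perm_eq (s ++ (c, e) :: r) ((c, e) :: s ++ r).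
  exact: permEl (perm_catCA s [:: (c, e)] r).
apply: (aniso_perm (mid (herm e (t0 :: cs')))); apply: an.
by apply: aniso_perm al; rewrite perm_sym; exact: mid.
Qed.

(** * Symplectic frames in nonsingular forms *)

Section Frames.
Variables (V : vectType F) (q : V -> F).
Hypotheses (quad_q : quadratic_form q) (nons_q : nonsingular q) (ani_q : anisotropic q).
Local Notation B := (polar q).

Lemma polarC v w : B v w = B w v.
Proof. by rewrite /polar [w + v]addrC addrAC. Qed.

Lemma polarDr u v w : B u (v + w) = B u v + B u w.
Proof. by case: quad_q => _ /(_ u 1 v w) + _; rewrite scale1r mul1r. Qed.

Lemma quad0 : q 0 = 0.
Proof. by case: quad_q => /(_ 0 0); rewrite scale0r expr2 !mul0r. Qed.

Lemma polar0r u : B u 0 = 0.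
Proof. by rewrite /polar addr0 subrr sub0r quad0 oppr0. Qed.

Lemma polarZr a u v : B u (a *: v) = a * B u v.
Proof. by case: quad_q => _ /(_ u a v 0) + _; rewrite addr0 polar0r addr0. Qed.

Lemma quadD v w : q (v + w) = q v + q w + B v w.
Proof. by rewrite /polar; move: (q _) (q v) (q w) => x y z; char2_ring. Qed.

Lemma quadZ a v : q (a *: v) = a * a * q v.
Proof. by case: quad_q => -> _ _; rewrite expr2. Qed.

Lemma polarvv v : B v v = 0.
Proof.
rewrite /polar (_ : v + v = 0); last first.
  by rewrite -mulr2n -scaler_nat (pcharf0 charF) scale0r.
by rewrite quad0 sub0r -opprD (addff charF) oppr0.
Qed.

Definition orthogonal_to v (us : seq V) := {in us, forall u, B u v = 0}.

Definition pair_vectors (s : seq (V * V)) := flatten [seq [:: p.1; p.2] | p <- s].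

Fixpoint frame (s : seq (V * V)) : Prop :=
  if s is p :: s' then
    [/\ B p.1 p.2 = 1, orthogonal_to p.1 (pair_vectors s'),
        orthogonal_to p.2 (pair_vectors s') & frame s']
  else True.

Lemma size_pair_vectors s : size (pair_vectors s) = (size s).*2.
Proof. by elim: s => //= p s ->. Qed.

Lemma orthogonal_span v us u : orthogonal_to v us -> u \in <<us>>%VS -> B u v = 0.
Proof.
move=> ov; pose f : {linear V -> F^o} := HB.pack (B v) (GRing.isLinear.Build F V F^o _
  (B v) (let: And3 _ h _ := quad_q in h v)).
suff /subvP sub : (<<us>> <= lker (linfun f))%VS.
  by move=> /sub; rewrite memv_ker lfunE /= polarC => /eqP.
by apply/span_subvP => w /ov wv; rewrite memv_ker lfunE /= polarC wv.
Qed.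

Lemma exists_orthogonal us : (size us < \dim {:V})%N ->
  exists2 v, v != 0 & orthogonal_to v us.
Proof.
move=> lt_us; pose f v : 'rV[F]_(size us) := \row_i B us`_i v.
have lin_f : linear f.
  by move=> a v w; apply/rowP => i; rewrite !mxE polarDr polarZr.
pose fM := GRing.isLinear.Build _ _ _ _ f lin_f.
pose g : {linear _ -> _} := HB.pack f fM.
pose K := lker (linfun g).
have K0 : K != 0%VS.
  have := limg_ker_dim (linfun g) fullv; rewrite capfv => dimK.
  apply: contraTneq lt_us => K0; move: dimK; rewrite -/K K0 dimv0 add0n => <-.
  rewrite -leqNgt (leq_trans (dimvS (subvf _))) // dimvf /dim /= mul1n.
  by [].
exists (vpick K); first by rewrite vpick0.
have : vpick K \in K := memv_pick K.
rewrite memv_ker lfunE /= => /eqP /rowP fv0 u /(nthP 0)[i lti <-].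
by have := fv0 (Ordinal lti); rewrite !mxE.
Qed.

(** Subtract the components of [w] along the frame. *)
Lemma frame_project s w : frame s -> exists2 w', orthogonal_to w' (pair_vectors s) &
  forall v, orthogonal_to v (pair_vectors s) -> B v w' = B v w.
Proof.
elim: s => [_|[e f] s IHs] /=; first by exists w.
move=> [ef oe of_ /IHs[w1 ow1 ew1]]; exists (w1 + (B f w1 *: e + B e w1 *: f)).
  move=> u; rewrite !inE => /or3P[/eqP->|/eqP->|us]; rewrite !polarDr !polarZr.
  - by rewrite polarvv /= ef; char2_ring.
  - by rewrite polarvv /= (polarC f e) ef; char2_ring.
  - by rewrite ow1 // oe // of_ // !mulr0 !addr0.
move=> v ov; rewrite !polarDr !polarZr (polarC v e) (polarC v f) !ov ?inE ?eqxx ?orbT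
  //.
rewrite !mulr0 !addr0 ew1 // => u us; apply: ov.
by rewrite !inE us !orbT.
Qed.

Lemma frame_extend s : frame s -> ((size s).*2 < \dim {:V})%N ->
  exists p, frame (p :: s).
Proof.
move=> fs; rewrite -size_pair_vectors => /exists_orthogonal[v v0 ov].
have [w vw] : exists w, B v w != 0.
  have [//|no] := classic (exists w, B v w != 0).
  case/eqP: v0; apply: nons_q => w; apply/eqP/negPn/negP => vw.
  by apply: no; exists w.
have [w' ow' ew'] := frame_project w fs.
exists (v, (B v w)^-1 *: w'); split=> //=; first by rewrite polarZr ew' // mulVf.
by move=> u us; rewrite polarZr ow' // mulr0.
Qed.

Lemma frame_size s : frame s -> ((size s).*2 <= \dim {:V})%N.
Proof.
move=> fs; have : free (pair_vectors s).
  elim: s fs => [_|[e f] s IHs [/= ef oe of_ fs]]; first exact: nil_free.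
  rewrite /pair_vectors /= free_cons free_cons IHs // andbT; apply/andP; split.
    apply/negP => /(orthogonal_span (v := f)) h; move: ef; rewrite h => [/eqP|u].
      by rewrite eq_sym oner_eq0.
    by rewrite inE => /predU1P[->|/of_ //]; rewrite polarvv.
  apply/negP => /(orthogonal_span oe); rewrite polarC ef => /eqP.
  by rewrite oner_eq0.
rewrite /free -size_pair_vectors => /eqP <-.
exact/dimvS/subvf.
Qed.

(** A frame that does not span can be extended, and a frame is free; so the
    dimension is even and some frame is a basis. *)
Lemma frame_exists : exists2 s, frame s & (size s).*2 = \dim {:V}.
Proof.
have [n le_n] := ubnP (\dim {:V}).
suff [s fs ge_s] : exists2 s, frame s & (\dim {:V} <= (size s).*2)%N.
  by exists s => //; apply/eqP; rewrite eqn_leq frame_size.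
have grow m : (exists2 s, frame s & (\dim {:V} <= (size s).*2)%N) \/
    (exists2 s, frame s & size s = m).
  elim: m => [|m [|[s fs sz]]]; [by right; exists [::]|by left|].
  case: (leqP (\dim {:V}) (size s).*2) => [|/(frame_extend fs)[p fp]]; first by left;
    exists s.
  by right; exists (p :: s); rewrite //= sz.
case: (grow n) => [//|[s fs sz]]; exists s => //.
by rewrite sz -addnn (leq_trans (ltnW le_n)) // leq_addr.
Qed.

(** Over a pair [(e, f)] with [B(e, f) = 1] the vectors [e] and [q(e) f] give the
    block [q(e) N_a] with [a = q(e) q(f)]. *)
Definition frame_blocks (s : seq (V * V)) := [seq (q p.1, q p.1 * q p.2) | p <- s].

Fixpoint frame_comb (s : seq (V * V)) (ns : seq (F * F)) : V :=
  match s, ns with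
  | p :: s', n :: ns' => (n.1 *: p.1 + (n.2 * q p.1) *: p.2) + frame_comb s' ns'
  | _, _ => 0
  end.

Lemma orthogonal_comb v s ns : orthogonal_to v (pair_vectors s) ->
  B v (frame_comb s ns) = 0.
Proof.
elim: s ns => [|p s IHs] [|n ns] //= ov; rewrite ?polar0r //.
rewrite !polarDr !polarZr (polarC v p.1) (polarC v p.2) !ov ?inE ?eqxx ?orbT //.
rewrite IHs ?mulr0 ?addr0 // => u us; apply: ov; by rewrite !inE us !orbT.
Qed.

Lemma quad_comb s ns : frame s -> q (frame_comb s ns) = eval_blocks (frame_blocks s) ns.
Proof.
elim: s ns => [|p s IHs] [|n ns] /=; try by rewrite quad0.
move=> [ef oe of_ fs]; rewrite quadD IHs // polarC polarDr !polarZr.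
rewrite !(polarC (frame_comb _ _)) !orthogonal_comb // !mulr0 !addr0.
rewrite quadD !quadZ polarZr polarC polarZr polarC ef /nrm /=; char2_ring.
Qed.

Lemma frame_aniso s : frame s -> aniso (frame_blocks s).
Proof.
move=> fs ns; rewrite size_map => sz ev0.
have c0 : frame_comb s ns = 0.
  by apply/eqP/negPn/negP => /ani_q; rewrite quad_comb // ev0 eqxx.
elim: s fs ns sz c0 {ev0} => [|p s IHs] fs [|n ns] //= [sz];
  case: fs => ef oe of_ fs c0.
have h1 : B p.1 (n.1 *: p.1 + (n.2 * q p.1) *: p.2 + frame_comb s ns) = 0.
  by rewrite c0 polar0r.
have h2 : B p.2 (n.1 *: p.1 + (n.2 * q p.1) *: p.2 + frame_comb s ns) = 0.
  by rewrite c0 polar0r.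
move: h1 h2; rewrite !polarDr !polarZr !orthogonal_comb // !polarvv (polarC p.2) ef.
rewrite !mulr0 !addr0 add0r !mulr1 => h2 h1.
have q0 : q p.1 != 0.
  apply: ani_q; apply/eqP => p0; move: ef; rewrite p0 polarC polar0r => /eqP.
  by rewrite eq_sym oner_eq0.
have {}h2 : n.2 = 0 by apply: (mulIf q0); rewrite mul0r.
rewrite (IHs fs _ sz) ?andbT; first by rewrite [n]surjective_pairing h1 h2.
by move: c0; rewrite h1 h2 mul0r !scale0r !add0r.
Qed.
End Frames.

(** * Forms built from blocks *)

Section BlockForm.
Variables (n : nat) (p a : 'I_n -> F).
Hypothesis p0 : forall i, p i != 0.

Definition block_form (v : 'M[F]_(n, 2)) : F :=
  \sum_(i < n) p i * nrm (a i) (v i 0, v i 1).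

Lemma block_polar v w : polar block_form v w =
  \sum_(i < n) p i * (v i 0 * w i 1 + v i 1 * w i 0).
Proof.
rewrite /polar /block_form -!sumrB; apply: eq_bigr => i _; rewrite !mxE /nrm /=.
char2_ring.
Qed.

Lemma block_quadratic : quadratic_form block_form.
Proof.
split=> [c v|v c u w|w c u v].
- rewrite /block_form mulr_sumr; apply: eq_bigr => i _; rewrite !mxE /nrm /=.
  char2_ring.
- rewrite !block_polar mulr_sumr -big_split; apply: eq_bigr => i _.
  rewrite !mxE /=; char2_ring.
rewrite !block_polar mulr_sumr -big_split; apply: eq_bigr => i _.
rewrite !mxE /=; char2_ring.
Qed.

Lemma block_nonsingular : nonsingular block_form.
Proof.
move=> v Bv; have test i (j k : 'I_2) :
    p i * (v i 0 * (delta_mx j k : 'M[F]_2) j 1 + v i 1 * (delta_mx j k : 'M[F]_2) j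
      0) = 0.
  rewrite -[RHS](Bv (delta_mx i k)) block_polar (bigD1 i) //= !mxE !eqxx.
  rewrite big1 ?addr0 // => l /negPf li; rewrite !mxE li /=.
  by rewrite !mulr0 addr0 mulr0.
apply/matrixP => i j; rewrite mxE; apply: (mulfI (p0 i)); rewrite mulr0.
case: j => [[|[|//]] ltj].
  rewrite -[RHS](test i 0 1) !mxE /= mulr1 mulr0 addr0; congr (_ * v _ _).
  exact: val_inj.
rewrite -[RHS](test i 0 0) !mxE /= mulr1 mulr0 add0r; congr (_ * v _ _).
exact: val_inj.
Qed.

Lemma block_dim : \dim {:'M[F]_(n, 2)} = n.*2.
Proof. by rewrite dimvf /dim /= muln2. Qed.

Local Notation H := {ffun 'I_(n + n) -> (F^o * F^o)%type}.

(** The entries of the standard hyperbolic plane live in the regular module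
    over [F]; these three maps keep all arithmetic in [F]. *)
Definition plane_point (x y : F) : F^o * F^o := (x, y).

(** For [q + q] evaluated at [(u, u + s)] one has
    [q(u) + q(u + s) = q(s) + B(u, s)].  Over the block [p N_a] this is
    [sx p (sx + sy + uy) + sy p (a sy + ux)], a sum of two hyperbolic planes. *)
Definition double_coord (u s : 'M[F]_(n, 2)) : H := [ffun k => match split k with
  | inl i => plane_point (s i 0) (p i * (s i 0 + s i 1 + u i 1))
  | inr i => plane_point (s i 1) (p i * (a i * s i 1 + u i 0))
  end].

Definition plane_fst (z : F^o * F^o) : F := z.1.
Definition plane_snd (z : F^o * F^o) : F := z.2.

Definition double_point (h : H) : 'M[F]_(n, 2) := \matrix_(i, j)
  let x := plane_fst (h (lshift n i)) in let y := plane_fst (h (rshift n i)) in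
  if j == 0 then a i * y + plane_snd (h (rshift n i)) / p i
  else x + y + plane_snd (h (lshift n i)) / p i.
Definition double_sum (h : H) : 'M[F]_(n, 2) := \matrix_(i, j)
  if j == 0 then plane_fst (h (lshift n i)) else plane_fst (h (rshift n i)).

Lemma hyperbolic_planeE (x y : F) : hyperbolic_plane (plane_point x y) = x * y.
Proof. by []. Qed.

Lemma double_form u s : block_form u + block_form (u + s) =
  orth_mul (@hyperbolic_plane F) (double_coord u s).
Proof.
rewrite /orth_mul /block_form -big_split /=. rewrite big_split_ord /= -big_split /=.
apply: eq_bigr => i _.
rewrite !ffunE (unsplitK (inl i)) (unsplitK (inr i)) !hyperbolic_planeE !mxE /nrm /=.
char2_ring.
Qed.

Lemma double_coord_linear c u s v t :
  double_coord (c *: u + v) (c *: s + t) = c *: double_coord u s + double_coord v t.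
Proof.
have pairE (x y x' y' : F) : c *: plane_point x y + plane_point x' y' =
    plane_point (c * x + x') (c * y + y') by [].
by apply/ffunP => k; rewrite !ffunE; case: (split k) => i;
  rewrite pairE !mxE; congr plane_point; move: (p i) (a i) (s i 0) (s i 1) (t i 0) (t
    i 1) (u i 0) (u i 1) (v i 0) (v i 1) => *; char2_ring.
Qed.

Lemma double_coordK u s :
  double_point (double_coord u s) = u /\ double_sum (double_coord u s) = s.
Proof.
have ord2 (j : 'I_2) : j <> 0 -> j = 1.
  by case: j => -[|[|//]] lt j0; [case: j0; apply: val_inj | apply: val_inj].
split; apply/matrixP => i j; rewrite !mxE !ffunE (unsplitK (inl i)) (unsplitK (inr i)).
  have p0i := p0 i; rewrite /plane_fst /plane_snd /=; case: eqP => [->|/ord2 ->].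
    by move: (s i 0) (s i 1) (u i 0) (u i 1) => *; char2_field.
  by move: (s i 0) (s i 1) (u i 0) (u i 1) => *; char2_field.
by case: eqP => [->|/ord2 ->].
Qed.

Lemma double_pointK h : double_coord (double_point h) (double_sum h) = h.
Proof.
have pointE z : plane_point (plane_fst z) (plane_snd z) = z by case: z.
apply/ffunP => k; rewrite -{2}[k]splitK ffunE.
by case: (split k) => i /=; rewrite !mxE /= -[RHS]pointE;
  congr plane_point; have p0i := p0 i; char2_field.
Qed.

(** The sum [q + q] becomes a sum of hyperbolic planes in the coordinates
    [double_coord]. *)
Lemma block_witt_order : finite_witt_order block_form.
Proof.
exists 2%N => //; exists 0%N, (n + n)%N.
pose f (x : {ffun 'I_2 -> 'M[F]_(n, 2)} * {ffun 'I_0 -> (F^o * F^o)%type}) :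
    'rV[F]_0 * H :=
  (0, double_coord (x.1 0) (x.1 0 + x.1 1)).
have lin_f : linear f.
  move=> c x y; congr (_, _); first by apply/rowP => -[].
  rewrite -double_coord_linear !ffunE scalerDr addrACA //.
pose fM := GRing.isLinear.Build _ _ _ _ f lin_f.
pose g : {linear _ -> _} := HB.pack f fM.
have addmm (v : 'M[F]_(n, 2)) : v + v = 0.
  by rewrite -mulr2n -scaler_nat (pcharf0 charF) scale0r.
have addKm (v w : 'M[F]_(n, 2)) : v + (v + w) = w by rewrite addrA addmm add0r.
exists g; split; last first.
  move=> x; rewrite /orth_sum /zero_form add0r /= -double_form addKm.
  rewrite /orth_mul [X in _ = _ + X]big_ord0 addr0 big_ord_recl big_ord1.
  by congr (_ + block_form (x.1 _)); apply: val_inj.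
pose h (y : 'rV[F]_0 * H) :
    {ffun 'I_2 -> 'M[F]_(n, 2)} * {ffun 'I_0 -> (F^o * F^o)%type} :=
  ([ffun j : 'I_2 => if j == 0 then double_point y.2 else double_point y.2 +
    double_sum y.2],
   [ffun i : 'I_0 => (0, 0)]).
exists h => [[x1 x2]|[y1 y2]]; rewrite /h /g /f /=.
  have [-> ->] := double_coordK (x1 0) (x1 0 + x1 1).
  congr (_, _); last by apply/ffunP => -[].
  apply/ffunP => j; rewrite ffunE; case: eqP => [->//|j0].
  rewrite addKm; congr (x1 _); case: j j0 => -[|[|//]] lt j0; last exact: val_inj.
  by case: j0; apply: val_inj.
rewrite !ffunE /= addKm double_pointK; congr (_, _).
by apply/rowP => -[].
Qed.

End BlockForm.

Lemma u_form_of_aniso (l : seq (F * F)) : aniso l -> u_form_dim F (size l).*2.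
Proof.
move=> al; pose p (i : 'I_(size l)) := (nth (0, 0) l i).1.
pose a (i : 'I_(size l)) := (nth (0, 0) l i).2.
have p0 i : p i != 0.
  have /perm_to_rem/aniso_perm/(_ al) : nth (0, 0) l i \in l by rewrite mem_nth.
  by rewrite [nth _ _ _]surjective_pairing => /aniso_neq0.
exists 'M[F]_(size l, 2), (block_form p a); split.
- exact: block_quadratic.
- exact: block_nonsingular.
- move=> v; apply: contraNneq => fv0.
  pose ns := [seq (v i 0, v i 1) | i <- enum 'I_(size l)].
  have szn : size ns = size l by rewrite size_map size_enum_ord.
  have nthn (i : 'I_(size l)) : nth (0, 0) ns i = (v i 0, v i 1).
    by rewrite (nth_map i) ?size_enum_ord // nth_ord_enum.
  have /(al _ szn)/(all_nthP (0, 0)) nz : eval_blocks l ns = 0.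
    rewrite -[RHS]fv0 eval_blocks_sum // /block_form -[X in iota 0 X]subn0
      -/(index_iota 0 _) big_mkord.
    by apply: eq_bigr => i _; rewrite nthn.
  apply/eqP/matrixP => i j; rewrite mxE.
  have := nz i; rewrite szn nthn => /(_ (ltn_ord i)) /eqP[v0 v1].
  case: j => -[|[|//]] lt; [rewrite -[RHS]v0|rewrite -[RHS]v1]; congr (v _ _);
    exact: val_inj.
- exact: block_witt_order.
exact: block_dim.
Qed.

Lemma u_form_blocks d : u_form_dim F d ->
  exists2 l : seq (F * F), aniso l & (size l).*2 = d.
Proof.
move=> [V [q [quad_q nons_q ani_q _ <-]]].
have [s fs sz] := frame_exists quad_q nons_q.
by exists (frame_blocks q s); rewrite ?size_map //; apply: frame_aniso.
Qed.

(** * Consequences of the isotropy of Albert forms *)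

Definition albert_isotropic := forall a b c d : F, b != 0 -> d != 0 ->
  exists n1 n2 n3,
  nonzero3 n1 n2 n3 /\ nrm (a + c) n1 + b * nrm a n2 + d * nrm c n3 = 0.

Lemma herm_perm (e : F) cs cs' : perm_eq cs cs' ->
  aniso (herm e cs) -> aniso (herm e cs').
Proof. by move=> p; apply: aniso_perm; apply: perm_map. Qed.

Lemma herm_coef (e : F) cs c : c \in cs -> aniso (herm e cs) -> c != 0.
Proof. by move=> /perm_to_rem/herm_perm h /(h e) /aniso_neq0. Qed.

Lemma herm_sel (e : F) k (Is : seq nat) cs : perm_eq Is (iota 0 (size cs)) ->
  aniso (herm e cs) -> aniso (herm e (take k [seq nth 0 cs i | i <- Is])).
Proof.
move=> pI; have /= := @aniso_sel k Is (herm e cs); rewrite size_map => /(_ pI) h /h.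
rewrite /herm map_take -map_comp; congr (aniso (take _ _)).
apply/eq_in_map => i; rewrite (perm_mem pI) mem_iota /= add0n => lti.
exact: nth_map.
Qed.

Section Linked.
Hypothesis albF : albert_isotropic.

Lemma albert_blocks (p1 p2 p3 a1 a2 : F) : p1 != 0 -> p2 != 0 -> p3 != 0 ->
  exists n1 n2 n3, nonzero3 n1 n2 n3 /\
  p1 * nrm a1 n1 + p2 * nrm a2 n2 + p3 * nrm (a1 + a2) n3 = 0.
Proof.
move=> p10 p20 p30; have [||n3 [n1 [n2 [nz e0]]]] := albF a1 (b := p1 / p3) a2 (d :=
  p2 / p3).
- by rewrite mulf_neq0 ?invr_eq0.
- by rewrite mulf_neq0 ?invr_eq0.
exists n1, n2, n3; split; first by move: nz; rewrite /nonzero3 orbC -orbA.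
transitivity (p3 * (nrm (a1 + a2) n3 + p1 / p3 * nrm a1 n1 + p2 / p3 * nrm a2 n2)).
  by move: (nrm _ n3) (nrm _ n2) (nrm _ n1) => x y z; char2_field.
by rewrite e0 mulr0.
Qed.

(** Once [n0] is normalized to [(t, 1)], the slots of the subforms
    [pi N_(e + xi N_e(ni))] of the three planes add up to [t^2 + t], so an Albert
    form embeds. *)
Lemma herm_triple (e : F) p1 p2 p3 x1 x2 x3 n0 n1 n2 n3 :
  nrm e n0 + x1 * nrm e n1 + x2 * nrm e n2 + x3 * nrm e n3 = 0 -> n0 != (0, 0) ->
  ~ aniso (herm e [:: p1; p1 * x1; p2; p2 * x2; p3; p3 * x3]).
Proof.
move=> e0 n0N al.
wlog n02 : n0 n1 n2 n3 e0 n0N / n0.2 = 1.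
  move=> th; case: (eqVneq n0.2 0) => [n020|n02]; last first.
    pose s n := (n0.2^-1 * n.1, n0.2^-1 * n.2) : F * F.
    apply: (th (s n0) (s n1) (s n2) (s n3)); rewrite /s.
    - transitivity (n0.2^-1 * n0.2^-1 * (nrm e n0 + x1 * nrm e n1 + x2 * nrm e n2 + x3
      * nrm e n3)).
        by rewrite !nrm_kscal; char2_ring.
      by rewrite e0 mulr0.
    - by rewrite mulVf // xpair_eqE oner_eq0 andbF.
    - by rewrite /= mulVf.
  have n01 : n0.1 != 0.
    by apply: contraNneq n0N => n01; rewrite [n0]surjective_pairing n01 n020.
  (* Multiplication by i turns a vector of trace 0 into one of trace 1. *)
  pose s n := kmul e (0, n0.1^-1) n.
  have s0 : s n0 = (0, 1).
    by rewrite /s /kmul /= n020 !mul0r !mulr0 !addr0 !add0r mulVf.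
  apply: (th (s n0) (s n1) (s n2) (s n3)).
  - transitivity (nrm e (0, n0.1^-1) * (nrm e n0 + x1 * nrm e n1 + x2 * nrm e n2 + x3
    * nrm e n3)).
      by rewrite /s !nrm_kmul; char2_ring.
    by rewrite e0 mulr0.
  - by rewrite s0 xpair_eqE oner_eq0 andbF.
  - by rewrite s0.
have p0 p : p \in [:: p1; p1 * x1; p2; p2 * x2; p3; p3 * x3] -> p != 0.
  by move=> /herm_coef; apply; exact: al.
have [||| m1 [m2 [m3 [nz em]]]] := @albert_blocks p1 p2 p3
   (e + x1 * nrm e n1) (e + x2 * nrm e n2); rewrite ?p0 ?inE ?eqxx ?orbT //.
pose X : F := n0.1; pose m3' : F * F := (m3.1 + X * m3.2, m3.2).
have := al [:: m1; kmul e (m1.2, 0) n1; m2; kmul e (m2.2, 0) n2; m3';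
  kmul e (m3.2, 0) n3].
rewrite /=; set v := (X in X = 0 -> _) => /(_ erefl) h; have /h {h} h : v = 0.
  rewrite /v -[RHS]em !nrm_kmul !nrm_scal.
  have : p3 * m3.2 * m3.2 * (nrm e n0 + x1 * nrm e n1 + x2 * nrm e n2 + x3 * nrm e n3)
    = 0.
    by rewrite e0 mulr0.
  rewrite {1}[n0]surjective_pairing n02 -/X /m3'.
  move: (nrm e n1) (nrm e n2) (nrm e n3) => N1 N2 N3 e1.
  rewrite -[RHS]addr0 -[X in _ = _ + X]e1 /nrm /=; char2_ring.
move: nz; rewrite /nonzero3 orbA; apply/negP; rewrite !negb_or !negbK.
case/and5P: h => -> _ -> _ /andP[/eqP[h1 h2] _] /=.
by move: h1; rewrite [m3]surjective_pairing /= h2 mulr0 addr0 => ->.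
Qed.

(** With [x1 = x2 = x3 = A] the relation needed by [herm_triple] always holds,
    since [N_e(1,0) + N_e(0,y) + N_e(1,y) = y] in characteristic 2.  So
    [<1, A, t, t A>] shares a value with [p <1, A>], and this value can be
    moved to [p] by multiplicativity of the quaternion norm. *)
Lemma herm_pfister_universal (e A t p : F) : ~ aniso (herm e [:: 1; A; t; t * A; p]).
Proof.
move=> al.
have p0 q : q \in [:: 1; A; t; t * A; p] -> q != 0.
  by move=> /herm_coef; apply; exact: al.
have A0 : A != 0 by rewrite p0 // !inE eqxx orbT.
have pN0 : p != 0 by rewrite p0 // !inE eqxx !orbT.
have e0 : e != 0.
  apply/eqP => e0; have /= := aniso_nrm_eq0 al (n := (0, 1)).
  by rewrite e0 /nrm /= !(mul0r, mulr0, addr0) => /(_ erefl)[/eqP]; rewrite oner_eq0.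
(* e + A (1 + e y^2 + (1 + y + e y^2)) = e + A y, which vanishes for y = e / A. *)
have rel : nrm e (0, 1) + A * nrm e (1, 0) + A * nrm e (0, e / A) +
    A * nrm e (1, e / A) = 0.
  by rewrite /nrm /=; char2_field.
have := @herm_triple e 1 t p A A A _ _ _ _ rel.
have n0 : (0, 1) != (0, 0) :> F * F by rewrite xpair_eqE oner_eq0 andbF.
move=> /(_ n0)/not_aniso[]; rewrite mul1r => -[|n1 [|n2 [|n3 [|n4 [|n5 [|n6 [|?
  ?]]]]]]] [] //= _.
move=> eq0 nz.
have [[e5 e6]|n56] := classic (n5 = (0, 0) /\ n6 = (0, 0)).
  have /negP := nz; apply; subst n5 n6; rewrite !eqxx /=.
  have := al [:: n1; n2; n3; n4; (0, 0)] erefl; rewrite /= eqxx; apply.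
  by rewrite -[RHS]eq0 !nrm0; char2_ring.
set nu := nrm e n5 + A * nrm e n6.
have nu0 : nu != 0.
  apply/eqP => nu0; apply: n56; have := al [:: n5; n6; (0, 0); (0, 0); (0, 0)] erefl.
  rewrite /= !nrm0 !(mulr0, addr0) mul1r => /(_ nu0)/and3P[/eqP -> /eqP -> _].
  by [].
have [k1 [k2 ek]] := quat_norm_mul e A n1 n2 n5 n6.
have [k3 [k4 ek']] := quat_norm_mul e A n3 n4 n5 n6.
have := al [:: k1; k2; k3; k4; (nu, 0)] erefl; rewrite /=;
  set v := (X in X = 0 -> _) => h.
have /h : v = 0; last by case/and5P=> _ _ _ _ /andP[/eqP[/eqP]]; rewrite (negPf nu0).
rewrite /v nrm_scal.
transitivity (nu * (1 * nrm e n1 + (A * nrm e n2 + (t * nrm e n3 + (t * A * nrm e n4 +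
  (p * nrm e n5 + (p * A * nrm e n6 + 0))))))); last by rewrite eq0 mulr0.
transitivity ((nrm e k1 + A * nrm e k2) + t * (nrm e k3 + A * nrm e k4) + p * (nu *
  nu)).
  by char2_ring.
by rewrite -ek -ek' /nu; char2_ring.
Qed.

(** Up to similarity and norms, rank 4 and trivial discriminant mean a
    Pfister form. *)
Lemma herm4_universal (e c1 c2 c3 c4 p : F) n : c1 * c2 * c3 * c4 = nrm e n ->
  ~ aniso (herm e [:: c1; c2; c3; c4; p]).
Proof.
move=> disc al.
have c0 q : q \in [:: c1; c2; c3; c4; p] -> q != 0.
  by move=> /herm_coef; apply; exact: al.
have c10 : c1 != 0 by rewrite c0 // !inE eqxx.
have c20 : c2 != 0 by rewrite c0 // !inE eqxx orbT.
have c30 : c3 != 0 by rewrite c0 // !inE eqxx !orbT.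
have c40 : c4 != 0 by rewrite c0 // !inE eqxx !orbT.
pose t : F := (c1 * c4)^-1; pose m := (t * n.1, t * n.2).
have em : nrm e m = c2 * c3 / (c1 * c4) by rewrite nrm_kscal -disc /t; char2_field.
have m0 : nrm e m != 0 by rewrite em !mulf_neq0 ?invr_eq0 ?mulf_neq0.
have := @aniso_norms e c1^-1 [:: c1; c2; c3; c4; p] [:: (1, 0); (1, 0); (1, 0); m;
  (1, 0)] _ erefl _ al.
rewrite invr_eq0 /= nrm_scal m0 mulr1 oner_eq0 => /(_ c10 isT).
rewrite !mulr1 mulVf // (_ : c1^-1 * (c4 * nrm e m) = c1^-1 * c3 * (c1^-1 * c2)).
  exact: herm_pfister_universal.
by rewrite em; char2_field.
Qed.

(** By universality [d n5 = n1 + x] with [x] a value of [<u, v, u v>].  Diagonalize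
    the latter as [<b, c, x>]; then [b c] is [x] up to a norm, and
    [herm_triple] applies to the pairs [(b, c)], [(g, d g)] and [(x, d)], with
    ratios [x], [d] and [d x] up to norms. *)
Lemma herm_albert_isotropic (e u v d g : F) :
  ~ aniso (herm e [:: u; v; u * v; d; g; d * g]).
Proof.
move=> al.
have c0 q : q \in [:: u; v; u * v; d; g; d * g] -> q != 0.
  by move=> /herm_coef; apply; exact: al.
have u0 : u != 0 by rewrite c0 // !inE eqxx.
have v0 : v != 0 by rewrite c0 // !inE eqxx orbT.
have d0 : d != 0 by rewrite c0 // !inE eqxx !orbT.
have /not_aniso[] := @herm_pfister_universal e u v d.
move=> [|n1 [|n2 [|n3 [|n4 [|n5 [|? ?]]]]]] [] //= _ eq0 nz.
have n10 : n1 != (0, 0).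
  apply/eqP => n10; move: nz; rewrite n10 eqxx /= => /negP; apply.
  have := al [:: n2; n3; n4; n5; (0, 0); (0, 0)] erefl.
  rewrite /= eqxx; apply; rewrite -[RHS]eq0 n10 !nrm0; char2_ring.
pose x : F := eval_blocks (herm e [:: u; v; u * v]) [:: n2; n3; n4].
have rel : nrm e n1 + x + d * nrm e n5 = 0.
  by rewrite -[RHS]eq0 /x /=; char2_ring.
have [x0|x0] := eqVneq x 0.
  have {}al := @herm_sel e 6 [:: 0; 1; 4; 5; 2; 3]%N [:: u; v; u * v; d; g;
    d * g] erefl al.
  have := @herm_triple e u g (u * v) (v / u) d (d / (u * v)) n1 (0, 0) n5 (0, 0).
  move: rel; rewrite x0 !nrm0 !mulr0 !addr0 => rel /(_ rel n10); apply.
  move: al; congr (aniso (herm e _)); rewrite /= mulrC.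
  by congr [:: _; _; _; _; _; _]; char2_field; rewrite mulf_neq0.
have [[|b [|c [|? ?]]] [k []]] := @herm_value e [:: u; v; u * v] [:: n2; n3;
  n4] erefl x0 => //= _.
rewrite !big_cons big_nil -[X in X * _]/x => pr an.
have {}al := an (herm e [:: d; g; d * g]) al.
have {}al := @herm_sel e 6 [:: 1; 2; 4; 5; 0; 3]%N [:: x; b; c; d; g; d * g] erefl al.
have b0 : b != 0 by apply: herm_coef al; rewrite !inE eqxx.
have cN0 : c != 0 by apply: herm_coef al; rewrite !inE eqxx orbT.
pose t : F := u * v / c.
have := @herm_triple e b g x (c / b) d (d / x) n1 (t * k.1, t * k.2) n5 (0, 0).
rewrite nrm0 mulr0 addr0 nrm_kscal.
have -> : c / b * (t * t * nrm e k) = x.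
  transitivity ((nrm e k * (u * (v * (u * v * 1)))) / (c * b)).
    by rewrite /t; char2_field.
  by rewrite -pr; char2_field.
move=> /(_ rel n10); apply; move: al; congr (aniso (herm e _)); rewrite /=.
by congr [:: _; _; _; _; _; _]; char2_field.
Qed.

(** Scaling by [c1 c2 c3] turns the two halves into pure parts of Pfister
    forms, up to norms. *)
Lemma herm6_isotropic (e c1 c2 c3 c4 c5 c6 : F) n :
  c1 * c2 * c3 * c4 * c5 * c6 = nrm e n ->
  ~ aniso (herm e [:: c1; c2; c3; c4; c5; c6]).
Proof.
move=> disc al.
have c0 q : q \in [:: c1; c2; c3; c4; c5; c6] -> q != 0.
  by move=> /herm_coef; apply; exact: al.
have c10 : c1 != 0 by rewrite c0 // !inE eqxx.
have c20 : c2 != 0 by rewrite c0 // !inE eqxx orbT.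
have c30 : c3 != 0 by rewrite c0 // !inE eqxx !orbT.
have c40 : c4 != 0 by rewrite c0 // !inE eqxx !orbT.
have c50 : c5 != 0 by rewrite c0 // !inE eqxx !orbT.
have c60 : c6 != 0 by rewrite c0 // !inE eqxx !orbT.
pose k : F := c1 * c2 * c3; have k0 : k != 0 by rewrite !mulf_neq0.
(* The discriminant enters here: k c6 and k c4 k c5 agree up to a norm. *)
pose m : F * F := (c6^-1 * n.1, c6^-1 * n.2).
have em : nrm e m = k * c4 * c5 / c6 by rewrite nrm_kscal -disc /k; char2_field.
have m0 : nrm e m != 0 by rewrite em !mulf_neq0 ?invr_eq0.
pose s c : F * F := (c^-1, 0).
have s0 c : c != 0 -> nrm e (s c) != 0.
  by move=> cN; rewrite nrm_scal mulf_neq0 ?invr_eq0.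
have := @aniso_norms e k [:: c1; c2; c3; c4; c5; c6] [:: s c1; s c2; (1, 0); (1, 0);
  (1, 0); m] k0 erefl _ al.
rewrite /= !s0 // m0 !nrm_scal !mulr1 oner_eq0 => /(_ isT).
rewrite [k * (c1 * _)](_ : _ = c2 * c3); last by rewrite /k; char2_field.
rewrite [k * (c2 * _)](_ : _ = c1 * c3); last by rewrite /k; char2_field.
rewrite [k * c3](_ : _ = c2 * c3 * (c1 * c3)); last by rewrite /k; char2_field.
rewrite [k * (c6 * _)](_ : _ = k * c4 * (k * c5)); last by rewrite em; char2_field.
exact: herm_albert_isotropic.
Qed.

(** Let [E = c1 c2 c3 c4].  By rank 6, [<c1,c2,c3,c4>] has a value
    [v = p (n5 + E n6)]; split it off as [<v, d2, d3, d4>].  Replacing [v] by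
    [v E] makes the discriminant trivial, so this form represents [p E], and
    [<d2, d3, d4>] has a value [w = E (v m1 + p m5)].  Since [E n6] is
    [n5 + v / p], multiplicativity of the norm of [[e, v / p)] shows that [w]
    is a value of [<v, p>] up to a norm: [<v, w, p>] is isotropic. *)
Lemma herm5_isotropic (e c1 c2 c3 c4 p : F) : ~ aniso (herm e [:: c1; c2; c3; c4; p]).
Proof.
move=> al.
have c0 q : q \in [:: c1; c2; c3; c4; p] -> q != 0.
  by move=> /herm_coef; apply; exact: al.
have c10 : c1 != 0 by rewrite c0 // !inE eqxx.
have c20 : c2 != 0 by rewrite c0 // !inE eqxx orbT.
have c30 : c3 != 0 by rewrite c0 // !inE eqxx !orbT.
have c40 : c4 != 0 by rewrite c0 // !inE eqxx !orbT.
have p0 : p != 0 by rewrite c0 // !inE eqxx !orbT.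
pose E : F := c1 * c2 * c3 * c4; have E0 : E != 0 by rewrite !mulf_neq0.
have : c1 * c2 * c3 * c4 * p * (E * p) = nrm e (E * p, 0).
  by rewrite nrm_scal /E; char2_ring.
move/herm6_isotropic/not_aniso => -[] [|n1 [|n2 [|n3 [|n4 [|n5 [|n6 [|? ?]]]]]]] []
  //= _ eq0 nz.
pose v : F := eval_blocks (herm e [:: c1; c2; c3; c4]) [:: n1; n2; n3; n4].
have def_v : v = p * (nrm e n5 + E * nrm e n6).
  rewrite -[LHS]addr0 -[X in _ + X]eq0 /v /=; char2_ring.
have ne n : nrm e n = 0 -> n = (0, 0) by apply: aniso_nrm_eq0 al.
have [v0|v0] := eqVneq v 0.
  have /al : eval_blocks (herm e [:: c1; c2; c3; c4; p]) [:: n1; n2; n3; n4;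
    (0, 0)] = 0.
    by rewrite -[RHS]v0 /v /= nrm0; char2_ring.
  move=> /(_ erefl) /and5P[/eqP z1 /eqP z2 /eqP z3 /eqP z4 _].
  move: nz; rewrite z1 z2 z3 z4 eqxx /= andbT => nz.
  move/esym/eqP: def_v; rewrite v0 mulf_eq0 (negPf p0) /= => /eqP e56.
  have n60 : nrm e n6 != 0.
    apply: contraNneq nz => /ne n60; move: e56; rewrite n60 nrm0 mulr0 addr0 => /ne ->.
    by rewrite eqxx.
  pose t : F := (nrm e n6)^-1; pose m := kmul e n5 n6.
  apply: (@herm4_universal e c1 c2 c3 c4 p (t * m.1, t * m.2)) al.
  rewrite nrm_kscal nrm_kmul -/E /t.
  transitivity ((nrm e n5 + E * nrm e n6) / nrm e n6 + nrm e n5 / nrm e n6); last first.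
    by rewrite e56; char2_field.
  by char2_field.
have [[|d2 [|d3 [|d4 [|? ?]]]] [k [//= _]]] := @herm_value e [:: c1; c2; c3;
  c4] [:: n1; n2; n3; n4] erefl v0.
rewrite -[X in X * _]/v !big_cons big_nil => pr /(_ (herm e [:: p]) al) al2.
have : v * E * d2 * d3 * d4 = nrm e (E * k.1, E * k.2).
  rewrite nrm_kscal; transitivity (E * (v * (d2 * (d3 * (d4 * 1)))));
    first by char2_ring.
  by rewrite pr /E; char2_ring.
move/(@herm4_universal _ _ _ _ _ (p * E))/not_aniso => -[] [|m1 [|m2 [|m3 [|m4 [|m5
  [|? ?]]]]]] [] //= _ eqm nzm.
pose w : F := eval_blocks (herm e [:: d2; d3; d4]) [:: m2; m3; m4].
have def_w : w = E * (v * nrm e m1 + p * nrm e m5).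
  rewrite -[LHS]addr0 -[X in _ + X]eqm /w /=; char2_ring.
have {}al2 : aniso (herm e [:: d2; d3; d4; v; p]).
  exact: (@herm_sel e 5 [:: 1; 2; 3; 0; 4]%N [:: v; d2; d3; d4; p] erefl al2).
have [w0|w0] := eqVneq w 0.
  have /al2 : eval_blocks (herm e [:: d2; d3; d4; v; p]) [:: m2; m3; m4; (0, 0);
    (0, 0)] = 0.
    by rewrite -[RHS]w0 /w /= nrm0; char2_ring.
  move=> /(_ erefl) /and5P[/eqP z2 /eqP z3 /eqP z4 _ _].
  move: nzm; rewrite z2 z3 z4 eqxx /=.
  move/esym/eqP: def_w; rewrite w0 mulf_eq0 (negPf E0) => /= /eqP m15.
  have := al2 [:: (0, 0); (0, 0); (0, 0); m1; m5] erefl;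
    rewrite /= nrm0 !mulr0 !add0r addr0.
  by move=> /(_ m15) /and5P[_ _ _ -> ->].
have [[|? [|? [|? ?]]] [? [//= _ _]]] := @herm_value e [:: d2; d3; d4] [:: m2; m3;
  m4] erefl w0.
move=> /(_ (herm e [:: v; p]) al2).
rewrite -[X in aniso ((X, _) :: _)]/w => /(@herm_sel e 3 [:: 0; 3; 4; 1; 2]%N [:: w;
  _; _; v; p] erefl) /= al3.
have [n60|n60] := eqVneq n6 (0, 0).
  have /al3 : eval_blocks (herm e [:: w; v; p]) [:: (0, 0); (1, 0); n5] = 0.
    by rewrite /= nrm0 nrm_scal def_v n60 nrm0; char2_ring.
  by move=> /(_ erefl)/and4P[_ /eqP[/eqP]]; rewrite oner_eq0.
have [k1 [k2 ek]] := quat_norm_mul e (v / p) n5 (1, 0) m5 m1.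
suff /al3 : eval_blocks (herm e [:: w; v; p]) [:: n6; k2; k1] = 0.
  by move=> /(_ erefl)/andP[/idPn]; rewrite n60.
rewrite /= def_w; transitivity (E * nrm e n6 * (v * nrm e m1 + p * nrm e m5) + p *
  (nrm e k1 + v / p * nrm e k2)).
  by char2_field.
rewrite -ek nrm_scal.
have -> : E * nrm e n6 = nrm e n5 + v / p by rewrite def_v; char2_field.
by char2_field.
Qed.

(** An isotropic vector whose trace coordinate is 0 is moved by a vector [u] that
    has trace coordinate 1 and is not orthogonal to it.  The result exhibits a
    common slot of [[a,b)] and [[c,d)], also when they are given to share only
    an inseparable extension. *)
Lemma albert_affine (a b c d : F) : b != 0 -> d != 0 -> exists t n2 n3,
  t * t + t + (a + c) + b * nrm a n2 + d * nrm c n3 = 0.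
Proof.
move=> b0 d0; have [[X Y] [n2 [n3 [nz e0]]]] := albF a c b0 d0.
have [Y0|Y0] := eqVneq Y 0; last first.
  exists (X / Y), (n2.1 / Y, n2.2 / Y), (n3.1 / Y, n3.2 / Y).
  transitivity ((nrm (a + c) (X, Y) + b * nrm a n2 + d * nrm c n3) / (Y * Y)).
    by rewrite /nrm /=; char2_field.
  by rewrite e0 mul0r.
(* B u2 u3 is the polar value of the isotropic vector at u = (0, 1; u2; u3). *)
pose B u2 u3 : F := X + b * (n2.1 * u2.2 + n2.2 * u2.1) + d * (n3.1 * u3.2 + n3.2 *
  u3.1).
have key (u2 u3 : F * F) : B u2 u3 != 0 -> exists t n2 n3,
    t * t + t + (a + c) + b * nrm a n2 + d * nrm c n3 = 0.
  move=> B0; pose l : F := (a + c + b * nrm a u2 + d * nrm c u3) / B u2 u3.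
  exists (l * X), (u2.1 + l * n2.1, u2.2 + l * n2.2), (u3.1 + l * n3.1,
    u3.2 + l * n3.2).
  transitivity (l * l * (nrm (a + c) (X, Y) + b * nrm a n2 + d * nrm c n3) +
    l * B u2 u3 + (a + c + b * nrm a u2 + d * nrm c u3)).
    by rewrite Y0 /B /nrm /=; char2_ring.
  by rewrite e0 mulr0 add0r /l mulfVK // (addff charF).
have [X0|X0] := eqVneq X 0; last first.
  by apply: (key (0, 0) (0, 0)); rewrite /B /= !(mulr0, addr0).
have [z2|z2] := eqVneq n2.1 0; last first.
  by apply: (key (0, 1) (0, 0)); rewrite /B /= X0 !(mulr0, addr0, add0r,
    mulr1) mulf_neq0.
have [w2|w2] := eqVneq n2.2 0; last first.
  by apply: (key (1, 0) (0, 0)); rewrite /B /= X0 !(mulr0, addr0, add0r,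
    mulr1) mulf_neq0.
have [z3|z3] := eqVneq n3.1 0; last first.
  by apply: (key (0, 0) (0, 1)); rewrite /B /= X0 !(mulr0, addr0, add0r,
    mulr1) mulf_neq0.
have [w3|w3] := eqVneq n3.2 0; last first.
  by apply: (key (0, 0) (1, 0)); rewrite /B /= X0 !(mulr0, addr0, add0r,
    mulr1) mulf_neq0.
move: nz; rewrite /nonzero3 X0 Y0 [n2]surjective_pairing [n3]surjective_pairing.
by rewrite z2 w2 z3 w3 eqxx.
Qed.

Lemma aniso_add_values (p1 a1 p2 a2 : F) r : aniso ((p1, a1) :: (p2, a2) :: r) ->
  aniso ((p1 + p2, (p1 + p2) * (a1 / p1)) :: (p2, p2 * (a1 / p1 + a2 / p2)) :: r).
Proof.
move=> al; have p10 := aniso_neq0 al.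
have p20 : p2 != 0.
  by apply: aniso_neq0 (aniso_perm _ al); apply: permEl (perm_catCA [:: (p1,
    a1)] [:: (p2, a2)] r).
have P0 : p1 + p2 != 0.
  apply/eqP => P0; have /= := @aniso_take 2 _ al; rewrite take0.
  move=> /(_ [:: (1, 0); (1, 0)] erefl); rewrite /= !nrm_scal !mulr1 addr0 => /(_ P0).
  by case/andP => /eqP[/eqP]; rewrite oner_eq0.
apply: aniso_head2 al => -[x1 y1] [x2 y2] /=.
exists (x1, (y1 * (p1 + p2) + y2 * p2) / p1), (x1 + x2, y2); split.
  by rewrite /nrm /=; char2_field.
move=> [-> h] [+ y20]; rewrite add0r => ->; rewrite y20; split=> //; congr (_, _).
apply: (mulIf P0); rewrite mul0r; apply: (mulIf (invr_neq0 p10)); rewrite mul0r.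
by rewrite -[RHS]h y20 mul0r addr0.
Qed.

(** The slots of [p n N_s + p N_a] may be shifted simultaneously by [al] as soon
    as [n] is a norm for the slot [al].  In terms of the basis vectors [e, f] of
    the first block and [g, h] of the second, replace [f] by
    [f + (x / y) e + (n / y) g] and [h] by [h + e / y + (x / y) g]. *)
Lemma aniso_shift_slots (p s a al x y : F) r (N := nrm al (x, y)) : y != 0 ->
  aniso ((p * N, s) :: (p, a) :: r) -> aniso ((p * N, s + al) :: (p, a + al) :: r).
Proof.
move=> y0; apply: aniso_head2 => -[x1 y1] [x2 y2] /=.
exists (x1 + y1 * x / y + y2 / y, y1), (x2 + y1 * N / y + y2 * x / y, y2); split.
  by rewrite /N /nrm /=; char2_field.
move=> [h1 y10] [h2 y20]; move: h1 h2; rewrite y10 y20 !mul0r !addr0 => -> ->.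
by [].
Qed.

(** In [c1 N_e + c2 N_e] add a vector of the second block to the vector [i] of the
    first one. *)
Lemma aniso_change_slot (c1 c2 e : F) n r : aniso ((c1, e) :: (c2, e) :: r) ->
  exists c2', aniso ((c1, e + c2 / c1 * nrm e n) :: (c2', e + c2 / c1 * nrm e n) :: r).
Proof.
move=> al; have c10 := aniso_neq0 al; have [N0|N0] := eqVneq (nrm e n) 0.
  by exists c2; rewrite N0 mulr0 addr0.
exists (c2 * nrm e n); apply: aniso_head2 al => -[x1 y1] [x2 y2] /=.
exists (x1 + y2 * (c2 * nrm e n) / c1, y1), (kmul e n (x2 + y1, y2)); split.
  rewrite nrm_kmul /nrm /=; char2_field.
move=> [h y10] /(kmul_eq0 N0)[]; rewrite y10 addr0 => x20 y20.
by move: h; rewrite x20 y20 !mul0r addr0 => ->.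
Qed.

Lemma aniso_swap (b c : F * F) r : aniso (b :: c :: r) -> aniso (c :: b :: r).
Proof. by apply: aniso_perm; apply: permEl (perm_catCA [:: b] [:: c] r). Qed.

Lemma aniso_rot (b c d : F * F) r :
  aniso (b :: c :: d :: r) -> aniso (c :: d :: b :: r).
Proof. by apply: aniso_perm; apply: permEl (perm_catCA [:: b] [:: c; d] r). Qed.

(** Let [al = a1 + a2].  The Albert form [p1 N_a1 + p2 N_a2 + p3 N_al] has an isotropic
    vector, so [p3 n] is a value of the first two blocks for a norm [n] of slot
    [al].  Splitting off this value leaves the slots [s] and [s + al], and
    [aniso_shift_slots], applied together with the third block, makes them
    equal. *)
Lemma aniso_three_blocks (b1 b2 b3 : F * F) r : aniso (b1 :: b2 :: b3 :: r) ->
  exists c1 c2 e p d, aniso ((c1, e) :: (c2, e) :: (p, d) :: r).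
Proof.
case: b1 b2 b3 => [p1 a1] [p2 a2] [p3 a3] al.
have p10 := aniso_neq0 al; have p20 := aniso_neq0 (aniso_rot al).
have p30 := aniso_neq0 (aniso_rot (aniso_rot al)).
have [n1 [n2 [[x y] [nz e0]]]] := albert_blocks a1 a2 p10 p20 p30.
have y0 : y != 0.
  apply/eqP => y0; move: nz; rewrite /nonzero3; apply/negP; rewrite !negb_or !negbK.
  have := @aniso_take 3 _ al; rewrite /= take0 => /(_ [:: n1; n2; (x, y)] erefl) /=.
  by rewrite andbT; apply; rewrite -[RHS]e0 y0 !nrm_scal; char2_ring.
have al3 b c : aniso [:: b, c, (p3, a3) & r] -> aniso [:: b, (p3, a3), c & r].
  by move=> /aniso_swap/aniso_rot.
have [N30|N30] := eqVneq (nrm (a1 + a2) (x, y)) 0.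
  exists p1, p2, a1, p3, a3.
  have := @aniso_artin_schreier _ _ (x / y) _ (aniso_swap al).
  rewrite (_ : a2 + _ = a1); first exact: aniso_swap.
  transitivity (a1 + nrm (a1 + a2) (x, y) / (y * y)); last by rewrite N30 mul0r addr0.
  by rewrite /nrm /=; char2_field.
have one q b c d s :
    aniso [:: (q, b), (p3, a3), (c, d) & r] -> q = p3 * nrm (a1 + a2) (x, y) ->
    b + (a1 + a2) = s ->
    aniso [:: (q, s), (c, d), (p3, a3 + (a1 + a2)) & r].
  move=> + qE <-; rewrite qE => /(aniso_shift_slots y0) h;
    exact/aniso_swap/aniso_rot/aniso_rot/h.
have [N10|N10] := eqVneq (nrm a1 n1) 0.
  have q : p2 * nrm a2 n2 = p3 * nrm (a1 + a2) (x, y).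
    rewrite -[LHS]addr0 -[X in _ + X]e0 N10; char2_ring.
  have N20 : nrm a2 n2 != 0.
    by apply: contraNneq N30 => N20; move/esym/eqP: q;
      rewrite N20 mulr0 mulf_eq0 (negPf p30).
  exists (p2 * nrm a2 n2), p1, a1, p3, (a3 + (a1 + a2)).
  apply: (one _ a2 _ _ _ _ q); last by char2_ring.
  by apply: aniso_scale => //; apply: aniso_rot.
have [N20|N20] := eqVneq (nrm a2 n2) 0.
  have q : p1 * nrm a1 n1 = p3 * nrm (a1 + a2) (x, y).
    rewrite -[LHS]addr0 -[X in _ + X]e0 N20; char2_ring.
  exists (p1 * nrm a1 n1), p2, a2, p3, (a3 + (a1 + a2)).
  apply: (one _ a1 _ _ _ _ q); last by char2_ring.
  by apply: aniso_scale => //; apply: al3.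
have {}al := aniso_scale N10 al; have {}al := aniso_scale N20 (aniso_swap al).
have := aniso_add_values (aniso_swap al).
set q1 := p1 * _; set q2 := p2 * _ => {}al.
have q10 : q1 != 0 by rewrite mulf_neq0.
have q20 : q2 != 0 by rewrite mulf_neq0.
exists (q1 + q2), q2, (q2 * (a1 / q1 + a2 / q2)), p3, (a3 + (a1 + a2)).
apply: (one _ _ _ _ _ (al3 _ _ al)).
  by rewrite -[LHS]addr0 -[X in _ + X]e0 /q1 /q2; char2_ring.
by char2_field.
Qed.

(** Two triples give [c1 N_e + c2 N_e + d1 N_g + d2 N_g + p N_d], and
    [albert_affine] makes [e] and [g] equal. *)
Lemma block5_isotropic (b1 b2 b3 b4 b5 : F * F) : ~ aniso [:: b1; b2; b3; b4; b5].
Proof.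
move=> /aniso_three_blocks[c1 [c2 [e [p [d al]]]]].
have {al} := @aniso_shuffle [:: 2; 3; 4; 0; 1]%N _ al isT => /= /aniso_three_blocks.
move=> [d1 [d2 [g [p' [de al]]]]].
have {}al := @aniso_shuffle [:: 3; 4; 0; 1; 2]%N _ al isT; rewrite /= in al.
have c10 := aniso_neq0 al.
have {}al := @aniso_shuffle [:: 2; 3; 0; 1; 4]%N _ al isT; rewrite /= in al.
have d10 := aniso_neq0 al.
have d20 := aniso_neq0 (@aniso_shuffle [:: 1; 2; 3; 0; 4]%N _ al isT).
have c20 := aniso_neq0 (@aniso_shuffle [:: 3; 2; 1; 0; 4]%N _ al isT).
have [||t [n [m rel]]] := @albert_affine e (c2 / c1) g (d2 / d1);
  rewrite ?mulf_neq0 ?invr_eq0 //.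
have [d2' {}al] := aniso_change_slot m al.
have slots : g + d2 / d1 * nrm g m + (t * t + t) = e + c2 / c1 * nrm e n.
  by rewrite -[LHS]addr0 -[X in _ + X]rel; char2_ring.
have {}al := @aniso_artin_schreier _ _ t _ al; rewrite slots in al.
have {}al := @aniso_shuffle [:: 1; 0; 2; 3; 4]%N _ al isT; rewrite /= in al.
have {}al := @aniso_artin_schreier _ _ t _ al; rewrite slots in al.
have {}al := @aniso_shuffle [:: 2; 3; 0; 1; 4]%N _ al isT; rewrite /= in al.
have [c2' {}al] := aniso_change_slot n al; move: al; set f := e + _ => al.
have /not_aniso[] := @herm5_isotropic f c1 c2' d2' d1 p'.
move=> [|n1 [|n2 [|n3 [|n4 [|n5 [|? ?]]]]]] [] //= _ eq0 nz.
have [N50|N50] := eqVneq (nrm f n5) 0.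
  have z5 := aniso_nrm_eq0 al N50; move: nz; rewrite z5 => /negP; apply.
  by apply: (al [:: n1; n2; n3; n4; (0, 0)]) => //=; rewrite -[RHS]eq0 z5 !nrm0.
suff /al : eval_blocks [:: (c1, f); (c2', f); (d2', f); (d1, f); (p', de)]
    [:: kmul f n1 n5; kmul f n2 n5; kmul f n3 n5; kmul f n4 n5; (nrm f n5, 0)] = 0.
  by move=> /(_ erefl)/and5P[_ _ _ _ /andP[/eqP[/eqP]]]; rewrite (negPf N50).
rewrite /= !nrm_kmul nrm_scal -[RHS](mul0r (nrm f n5)) -[X in _ = X * _]eq0; char2_ring.
Qed.

(** If the four blocks were isotropic then [p] times a quaternion norm would be a
    value of [<c1, c2>], a multiple of the same norm form, and hence so
    would [p]. *)
Lemma block4_of_block3 (b1 b2 b3 : F * F) : aniso [:: b1; b2; b3] ->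
  exists2 l : seq (F * F), size l = 4%N & aniso l.
Proof.
move=> /aniso_three_blocks[c1 [c2 [e [p [d al]]]]]; have c10 := aniso_neq0 al.
pose A : F := c2 / c1; have cA : c2 = c1 * A by rewrite /A; char2_field.
exists (herm e [:: c1; c1 * A; p; p * A]) => //.
have [//|/not_aniso[]] := classic (aniso (herm e [:: c1; c1 * A; p; p * A])).
move=> [|n1 [|n2 [|n3 [|n4 [|? ?]]]]] [] //= _ eq0 nz.
exfalso; pose nu : F := nrm e n3 + A * nrm e n4.
have [nu0|nu0] := eqVneq nu 0.
  have e3 : eval_blocks [:: (c1, e); (c2, e); (p, d)] [:: n3; n4; (0, 0)] = 0.
    transitivity (c1 * nu); last by rewrite nu0 mulr0.
    by rewrite cA /nu /= nrm0; char2_ring.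
  have /and3P[/eqP z3 /eqP z4 _] := al [:: n3; n4; (0, 0)] erefl e3.
  have e1 : eval_blocks [:: (c1, e); (c2, e); (p, d)] [:: n1; n2; (0, 0)] = 0.
    by rewrite -[RHS]eq0 z3 z4 cA /= !nrm0; char2_ring.
  have /and3P[/eqP z1 /eqP z2 _] := al [:: n1; n2; (0, 0)] erefl e1.
  by move: nz; rewrite z3 z4 z1 z2 !eqxx.
have [k1 [k2 ek]] := quat_norm_mul e A n1 n2 n3 n4.
have e3 : eval_blocks [:: (c1, e); (c2, e); (p, d)] [:: k1; k2; (nu, 0)] = 0.
  rewrite /= nrm_scal cA.
  transitivity (c1 * (nrm e k1 + A * nrm e k2) + p * nu * nu); first by char2_ring.
  rewrite -ek; transitivity (nu * (c1 * nrm e n1 + (c1 * A * nrm e n2 + (p * nrm e n3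
    + (p * A * nrm e n4 + 0))))).
    by rewrite /nu; char2_ring.
  by rewrite eq0 mulr0.
have /and3P[_ _ /andP[/eqP[/eqP]]] := al [:: k1; k2; (nu, 0)] erefl e3.
by rewrite (negPf nu0).
Qed.

End Linked.

Lemma linked_u_form d : linked_field F -> u_form_dim F d ->
  d \in [:: 0; 2; 4; 6; 8]%N.
Proof.
move=> /linked_albert albF /u_form_blocks[l al <-].
case: l al => [|b1 [|b2 [|b3 [|b4 [|b5 l]]]]] //= al.
have := aniso_take (k := 5%N) al; rewrite /= take0.
by move=> /(block5_isotropic albF).
Qed.

Lemma linked_u_form6 : linked_field F -> u_form_dim F 6 -> u_form_dim F 8.
Proof.
move=> /linked_albert albF /u_form_blocks[[|b1 [|b2 [|b3 [|? ?]]]]] //= al _.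
have [l szl /u_form_of_aniso] := block4_of_block3 albF al.
by rewrite szl.
Qed.
End CharTwo.

Theorem corollary5p2 (F : fieldType) (charF : 2%N \in [pchar F]%R)
  (linkedF : linked_field F) :
  exists2 n : nat, n \in [:: 0; 2; 4; 8]%N & u_invariant_is F n.
Proof.
have dims := @linked_u_form F charF _ linkedF.
have [u8|no8] := classic (u_form_dim F 8).
  exists 8%N => //; split=> // d /dims; rewrite !inE.
  by move=> /or4P[/eqP->|/eqP->|/eqP->|/orP[]/eqP->].
have no6 : ~ u_form_dim F 6 by move=> /(linked_u_form6 charF linkedF).
have [u4|no4] := classic (u_form_dim F 4).
  exists 4%N => //; split=> // d ud; move: ud (dims d ud); rewrite !inE => + /or4P dval.
  by case: dval => [/eqP->|/eqP->|/eqP->|/orP[]/eqP->].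
have [u2|no2] := classic (u_form_dim F 2).
  exists 2%N => //; split=> // d ud; move: ud (dims d ud); rewrite !inE => + /or4P dval.
  by case: dval => [/eqP->|/eqP->|/eqP->|/orP[]/eqP->].
exists 0%N => //; split.
  by apply: (@u_form_of_aniso F charF [::]) => -[].
move=> d ud; move: ud (dims d ud); rewrite !inE => + /or4P dval.
  by case: dval => [/eqP->|/eqP->|/eqP->|/orP[]/eqP->].
Qed.
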